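(* Let $s\in(0,1)$ and $N>2s$. Let $f\in C([0,\infty))$ with $f(0)=0$ satisfy: (f1) $\lim_{t\to0}\frac{f(t)}{t}=0$, $\lim_{t\to\infty}\frac{f(t)}{t}=\infty$, and $\lim_{t\to\infty}\frac{f(t)}{t^{\gamma-1}}\le C(f)$ for some $\gamma\in(2,2^*_s)$ and some constant $C(f)>0$; (f2) there exists $R>0$ such that $\frac{f(t)}{t}$ is increasing for $t>R$; ($\tilde{\mathrm f}$1) $\lim_{t\to\infty}\frac{f(t)}{t^{2^*_s-1}}=0$. Let $g\in L^1(\mathbb{R}^N)\cap L^\infty(\mathbb{R}^N)$ be positive. Let $a_1>0$, $a_2\in(0,a_1)$ and the mountain pass solutions $(u_a)_{a\in(0,a_2)}$ of $(-\Delta)^su=g(x)f_a(u)$ in $\mathbb{R}^N$ be as fixed in the context (in particular $\sup_{a\in(0,a_2)}\|u_a\|_{\dot H^s(\mathbb{R}^N)}<\infty$). Then for every $r\in[2^*_s,\infty]$ and every $a\in(0,a_2)$, $u_a\in L^r(\mathbb{R}^N)\cap C(\mathbb{R}^N)$. Moreover, there exists a constant $C=C(r,N,s,f,g)>0$, independent of $a$, such that $\|u_a\|_{L^r(\mathbb{R}^N)}\le C$ for all $a\in(0,a_2)$.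
   Context: Here $2^*_s=\frac{2N}{N-2s}$. For $a\geq 0$, $f_a(t)=f(t)-a$ if $t\ge0$ and $f_a(t)=-a$ if $t\le0$; $F_a(t)=\int_0^t f_a(\tau)\,d\tau$. $[u]_{s,2}=\left(\iint_{\mathbb{R}^N\times\mathbb{R}^N}\frac{(u(x)-u(y))^2}{|x-y|^{N+2s}}\,dx\,dy\right)^{1/2}$ and $\|u\|_{\dot H^s(\mathbb{R}^N)}=[u]_{s,2}+\|u\|_{L^{2^*_s}(\mathbb{R}^N)}$. The space $\dot H^s(\mathbb{R}^N)$ is the closure of $C_c^1(\mathbb{R}^N)$ with respect to this norm; equivalently, the space of measurable $u:\mathbb{R}^N\to\mathbb{R}$ with $[u]_{s,2}+\|u\|_{L^{2^*_s}(\mathbb{R}^N)}<\infty$. The seminorm $[\cdot]_{s,2}$ is an equivalent norm on it. A function $u\in\dot H^s(\mathbb{R}^N)$ is a weak solution of $(-\Delta)^su=g f_a(u)$ in $\mathbb{R}^N$ if $$\iint_{\mathbb{R}^N\times\mathbb{R}^N}\frac{(u(x)-u(y))(\phi(x)-\phi(y))}{|x-y|^{N+2s}}\,dx\,dy=\int_{\mathbb{R}^N}g(x)f_a(u)\phi(x)\,dx\quad\forall\phi\in\dot H^s(\mathbb{R}^N).$$ The associated energy functional is $I_a(u)=\frac12[u]_{s,2}^2-\int_{\mathbb{R}^N}gF_a(u)\,dx$, which is $C^1$ on $\dot H^s(\mathbb{R}^N)$; its critical points are the weak solutions. Fixed data (these exist under (f1), (f2) and $g\in L^1\cap L^\infty$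 positive, and their choice is regarded as determined by $N,s,f,g$): numbers $\rho,\beta,a_1>0$ such that for all $a\in(0,a_1)$, $I_a(u)\ge\beta$ whenever $[u]_{s,2}=\rho$; for each $a\in(0,a_1)$ a mountain pass solution $u_a$, that is, $u_a\in\dot H^s(\mathbb{R}^N)$ with $I_a'(u_a)=0$ and $$I_a(u_a)=\inf_{\gamma\in\Gamma_{\tilde u}}\max_{\sigma\in[0,1]}I_a(\gamma(\sigma))\ge\beta,\qquad \Gamma_{\tilde u}=\{\gamma\in C([0,1],\dot H^s(\mathbb{R}^N)):\gamma(0)=0,\ \gamma(1)=\tilde u\},$$ for some $\tilde u\in\dot H^s(\mathbb{R}^N)$ with $[\tilde u]_{s,2}>\rho$ and $I_a(\tilde u)<0$; and numbers $a_2\in(0,a_1)$, $C_0>0$ with $\|u_a\|_{\dot H^s(\mathbb{R}^N)}\le C_0$ for all $a\in(0,a_2)$. Continuity of $u_a$ means that $u_a$ has a continuous representative. *)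

(* Defs.v *)
From HB Require Import structures.
From mathcomp Require Import all_boot all_order all_algebra.
From mathcomp Require Import all_classical all_reals all_analysis.

Set Implicit Arguments.
Unset Strict Implicit.
Unset Printing Implicit Defensive.

Import Order.TTheory GRing.Theory Num.Theory.
Import numFieldNormedType.Exports.

Local Open Scope classical_set_scope.
Local Open Scope ring_scope.

(* R^n is 'rV[R]_n: the library provides its topology; its Borel
   sigma-algebra is the one generated by the coordinates. *)
Definition rV_display : measure_display. Proof. exact: default_measure_display. Qed.

Section measurable_rV.
Context (R : realType) (n : nat).

Let coord (i : 'I_n) (x : 'rV[R]_n) : measurableTypeR R := x 0 i.

Let rV_set0 : g_sigma_preimage coord set0.
Proof. exact: sigma_algebra0. Qed.

Let rV_setC A : g_sigma_preimage coord A -> g_sigma_preimage coord (~` A).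
Proof. exact: sigma_algebraC. Qed.

Let rV_bigcup (F : (set 'rV[R]_n)^nat) :
  (forall i, g_sigma_preimage coord (F i)) ->
  g_sigma_preimage coord (\bigcup_i (F i)).
Proof. exact: sigma_algebra_bigcup. Qed.

HB.instance Definition _ := @isMeasurable.Build rV_display
  'rV[R]_n (g_sigma_preimage coord) rV_set0 rV_setC rV_bigcup.

End measurable_rV.

Lemma measurable_coord_rV (R : realType) n (i : 'I_n) :
  measurable_fun [set: 'rV[R]_n] (fun x => x 0 i : measurableTypeR R).
Proof.
move=> _ Y mY; rewrite setTI; apply: sub_sigma_algebra => /=.
rewrite -bigcup_seq/=; exists i => /=; first by rewrite mem_index_enum.
by exists Y => //; rewrite setTI.
Qed.

Lemma measurable_fun_rV d (T : measurableType d) (R : realType) n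
    (f : T -> 'rV[R]_n) :
  (forall i, measurable_fun [set: T] (fun t => f t 0 i : measurableTypeR R)) ->
  measurable_fun [set: T] f.
Proof.
move=> mf _ A mA; rewrite setTI.
pose coord (i : 'I_n) (x : 'rV[R]_n) : measurableTypeR R := x 0 i.
have : preimage_set_system setT f (g_sigma_preimage coord) (f @^-1` A).
  by exists A => //; rewrite setTI.
rewrite -g_sigma_preimage_comp; apply: smallest_sub.
  exact: sigma_algebra_measurable.
rewrite -bigcup_seq => B [i _] [C mC <-].
exact: mf.
Qed.

Section lebesgue_rV_step.
Context (R : realType) (n : nat).

Definition rV_cons (p : measurableTypeR R * 'rV[R]_n) : 'rV[R]_n.+1 :=
  row_mx (const_mx p.1 : 'rV_1) p.2.

Lemma rV_consE0 p : rV_cons p 0 0 = p.1.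
Proof.
have := @row_mxEl R 1 1 n (const_mx p.1) p.2 0 0.
by rewrite [in RHS]mxE => <-; congr (row_mx _ _ _ _); exact/val_inj.
Qed.

Lemma rV_consES p i : rV_cons p 0 (lift ord0 i) = p.2 0 i.
Proof.
rewrite -(@row_mxEr R 1 1 n (const_mx p.1) p.2 0 i).
by congr (row_mx _ _ _ _); exact/val_inj.
Qed.

Lemma measurable_rV_cons : measurable_fun setT rV_cons.
Proof.
apply: measurable_fun_rV => i.
case: (unliftP ord0 i) => [j ->|->].
  rewrite (_ : (fun _ => _) =
    (fun x : 'rV[R]_n => x 0 j : measurableTypeR R) \o snd).
    exact: (measurableT_comp (measurable_coord_rV j)).
  by apply/funext => p; exact: rV_consES.
rewrite (_ : (fun _ => _) = fst)//; apply/funext => p.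
exact: rV_consE0.
Qed.

Variable mu : {sigma_finite_measure set 'rV[R]_n -> \bar R}.

Definition lebesgue_rV_step : set 'rV[R]_n.+1 -> \bar R :=
  pushforward (@lebesgue_measure R \x mu)%E rV_cons.

Let mf := measurable_rV_cons.

Let step0 : lebesgue_rV_step set0 = 0%E.
Proof. exact: measure0. Qed.

Let step_ge0 A : (0 <= lebesgue_rV_step A)%E.
Proof. exact: measure_ge0. Qed.

Let step_sigma_additive : semi_sigma_additive lebesgue_rV_step.
Proof. exact: measure_semi_sigma_additive. Qed.

HB.instance Definition _ := isMeasure.Build _ _ _ lebesgue_rV_step
  step0 step_ge0 step_sigma_additive.

Let sigma_finite_step : sigma_finite setT lebesgue_rV_step.
Proof.
have /sigma_finiteP[F [FT ndF mF]] := sigma_finiteT (@lebesgue_measure R).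
have /sigma_finiteP[G [GT ndG mG]] := sigma_finiteT mu.
pose h (x : 'rV[R]_n.+1) : measurableTypeR R * 'rV[R]_n :=
  (x 0 0, \row_i x 0 (lift ord0 i)).
have mh : measurable_fun setT h.
  apply: measurable_fun_pair; first exact: measurable_coord_rV.
  apply: measurable_fun_rV => i /=.
  rewrite (_ : (fun _ => _) =
    (fun x : 'rV[R]_n.+1 => x 0 (lift ord0 i) : measurableTypeR R)).
    exact: measurable_coord_rV.
  by apply/funext => x; rewrite mxE.
have hK p : h (rV_cons p) = p.
  rewrite /h rV_consE0 [RHS]surjective_pairing; congr pair.
  by apply/rowP => i; rewrite mxE rV_consES.
exists (fun k => h @^-1` (F k `*` G k)).
  rewrite -preimage_bigcup; apply/esym/seteqP; split => // x _ /=.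
  have [i _ Fi] : (\bigcup_i F i) (h x).1 by rewrite -FT.
  have [j _ Gj] : (\bigcup_j G j) (h x).2 by rewrite -GT.
  exists (maxn i j) => //; split.
    by move: Fi; exact/subsetPset/ndF/leq_maxl.
  by move: Gj; exact/subsetPset/ndG/leq_maxr.
move=> k; have [mFk Fkoo] := mF k; have [mGk Gkoo] := mG k; split.
  by rewrite -[X in measurable X]setTI; apply: mh => //; exact: measurableX.
rewrite /lebesgue_rV_step /pushforward.
rewrite (_ : _ @^-1` _ = F k `*` G k); last first.
  by rewrite -comp_preimage (_ : h \o rV_cons = id)//; exact/funext.
by rewrite product_measure1E// lte_mul_pinfty// ge0_fin_numE.
Qed.

HB.instance Definition _ :=
  Measure_isSigmaFinite.Build _ _ _ lebesgue_rV_step sigma_finite_step.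

End lebesgue_rV_step.

Fixpoint lebesgue_rV (R : realType) (n : nat) :
    {sigma_finite_measure set 'rV[R]_n -> \bar R} :=
  if n is m.+1 then lebesgue_rV_step (lebesgue_rV R m) else \d_(0 : 'rV[R]_0).

Lemma lebesgue_rV_box (R : realType) n (A : 'I_n -> set (measurableTypeR R)) :
  (forall i, measurable (A i)) ->
  lebesgue_rV R n [set x | forall i, A i (x 0 i)] =
  (\prod_(i < n) lebesgue_measure (A i))%E.
Proof.
elim: n A => [|n IHn] A mA.
  by rewrite big_ord0 /= diracE mem_set// => -[].
rewrite big_ord_recl -IHn// /= /lebesgue_rV_step /pushforward.
rewrite -product_measure1E//; last first.
  rewrite (_ : (fun _ => _) = \bigcap_(i : 'I_n)
    ((fun x : 'rV[R]_n => x 0 i : measurableTypeR R) @^-1` (A (lift ord0 i)))).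
    apply: fin_bigcap_measurable => // i _.
    by rewrite -[X in measurable X]setTI; exact: measurable_coord_rV.
  by apply/seteqP; split=> [x Ax i _|x Ax i]; exact: Ax.
congr (_ _); apply/seteqP; split=> -[x y].
  move=> Axy; split; first by have := Axy ord0; rewrite rV_consE0.
  by move=> i; have := Axy (lift ord0 i); rewrite rV_consES.
move=> [/= Ax Ay] i; case: (unliftP ord0 i) => [j ->|->].
  by rewrite rV_consES; exact: Ay.
by rewrite rV_consE0.
Qed.

(* The library norm on 'rV[R]_N is the sup norm. *)
Definition enorm (R : realType) N (x : 'rV[R]_N) : R :=
  Num.sqrt (\sum_(i < N) x 0 i ^+ 2).

Section homogeneous_fractional_sobolev.
Context (R : realType) (N : nat).
Implicit Types (s : R) (u : 'rV[R]_N -> R).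

Definition critical_exponent s : R := 2 * N%:R / (N%:R - 2 * s).

(* The integrand is 0 on the diagonal, a null set, since 0^-1 = 0. *)
Definition gagliardo s u : \bar R :=
  ((\int[lebesgue_rV R N \x lebesgue_rV R N]_z
     ((u z.1 - u z.2) ^+ 2 / enorm (z.1 - z.2) `^ (N%:R + 2 * s))%:E) `^ 2^-1)%E.

Definition Hdot_norm s u : \bar R :=
  (gagliardo s u
   + 'N[lebesgue_rV R N]_((critical_exponent s)%:E)[EFin \o u])%E.

(* Elements are representatives; almost everywhere equal functions are at
   Hdot_norm-distance 0. *)
Definition Hdot s : set ('rV[R]_N -> R) :=
  [set u | measurable_fun setT u /\ (Hdot_norm s u < +oo)%E].

End homogeneous_fractional_sobolev.

Section semipositone_energy.
Context (R : realType) (N : nat).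
Variables (s : R) (f : R -> R) (g : 'rV[R]_N -> R) (a : R).
Implicit Types (u v phi : 'rV[R]_N -> R).

Definition shifted (t : R) : R := if 0 <= t then f t - a else - a.

Definition shifted_primitive (t : R) : R :=
  if 0 <= t then \int[lebesgue_measure]_(x in `[0, t]) shifted x
  else - \int[lebesgue_measure]_(x in `[t, 0]) shifted x.

Definition energy u : R :=
  2^-1 * fine (gagliardo s u) ^+ 2
  - \int[lebesgue_rV R N]_x (g x * shifted_primitive (u x)).

(* The Frechet derivative of the energy at u is 0. *)
Definition critical_point u : Prop :=
  forall eps : R, 0 < eps -> exists2 delta : R, 0 < delta &
    forall phi, Hdot s phi -> (Hdot_norm s phi <= delta%:E)%E ->
      (`|energy (u \+ phi) - energy u|%R%:E <= eps%:E * Hdot_norm s phi)%E.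

Definition paths v : set (R -> 'rV[R]_N -> R) :=
  [set gam : R -> 'rV[R]_N -> R |
    [/\ forall t, t \in `[0, 1] -> Hdot s (gam t),
        forall t, t \in `[0, 1] -> forall eps : R, 0 < eps ->
          exists2 delta : R, 0 < delta &
            forall t', t' \in `[0, 1] -> `|t' - t| < delta ->
              (Hdot_norm s (gam t' \- gam t)%R < eps%:E)%E,
        gam 0 = cst 0 %[ae lebesgue_rV R N] &
        gam 1 = v %[ae lebesgue_rV R N]]].

Definition is_path_max (gam : R -> 'rV[R]_N -> R) (m : R) : Prop :=
  (exists2 t, t \in `[0, 1] & energy (gam t) = m) /\
  (forall t, t \in `[0, 1] -> energy (gam t) <= m).

Definition mountain_pass_level v : R :=
  inf [set m : R | exists2 gam, paths v gam & is_path_max gam m].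

Definition mountain_pass_solution (rho beta : R) u : Prop :=
  [/\ Hdot s u, critical_point u &
    exists v, [/\ Hdot s v, (rho%:E < gagliardo s v)%E, energy v < 0,
      energy u = mountain_pass_level v & beta <= energy u]].

End semipositone_energy.

Section hypotheses_on_f.
Context (R : realType).
Variables (f : R -> R).

(* q stands for the critical exponent. *)
Definition condition_f1 (q : R) : Prop :=
  [/\ f t / t @[t --> 0^'+] --> (0 : R),
      f t / t @[t --> +oo] --> +oo &
      exists gamma C l : R, [/\ 2 < gamma < q, 0 < C,
        f t / t `^ (gamma - 1) @[t --> +oo] --> l & l <= C]].

Definition condition_f2 : Prop :=
  exists2 r : R, 0 < r &
    forall t t', r < t -> t <= t' -> f t / t <= f t' / t'.

Definition condition_f1_tilde (q : R) : Prop :=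
  f t / t `^ (q - 1) @[t --> +oo] --> (0 : R).

End hypotheses_on_f.

Definition has_continuous_representative (R : realType) N
    (u : 'rV[R]_N -> R) : Prop :=
  exists2 v : 'rV[R]_N -> R, continuous v & u = v %[ae lebesgue_rV R N].

(* Main.v *)
Require Import Defs.
From HB Require Import structures.
From mathcomp Require Import all_boot all_order all_algebra.
From mathcomp Require Import all_classical all_reals all_analysis.
From mathcomp Require Import measurable_realfun ess_sup_inf.
From mathcomp Require Import ring lra.

Set Implicit Arguments.
Unset Strict Implicit.
Unset Printing Implicit Defensive.

Import Order.TTheory GRing.Theory Num.Theory.
Import numFieldNormedType.Exports.

Local Open Scope classical_set_scope.
Local Open Scope ring_scope.

(** Write [u]^2 for the double integral of (u(x) - u(y))^2 / |x - y|^(N + 2s)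
    and q for the critical exponent 2N / (N - 2s). The solutions are bounded,
    uniformly in a, by a De Giorgi iteration. The same iteration, applied to
    the differences u(. + z) - u, makes them continuous.

    Test functions. Since the energy has derivative 0 at u, replacing u by
    u + t psi cannot lower [u]^2 by more than twice the change of the potential
    term, up to o(t); the growth |f(t)| <= C (1 + t^(gam - 1)) with gam < q turns
    this into a bound by t times the integral of |psi| (1 + |u|^(gam - 1))
    ([critical_quasiminimal]). With psi = - (u - k)_+ the elementary inequality
    (X - Y) (X_+ - Y_+) >= (X_+ - Y_+)^2 gives a Caccioppoli inequality: [(u - k)_+]^2
    is at most a constant times the integral of (u - k)_+ (1 + |u|^(gam - 1))
    ([caccioppoli]); the same holds for - u.

    Boundedness. Set Y_n to the integral of ((u - k_n)_+)^q along levels k_n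
    that increase to K. The Sobolev inequality ([sobolev]) and the Caccioppoli
    inequality give Y_(n+1)^(2/q) <= a b^n Y_n, and 2/q < 1, so that Y_n tends to 0,
    that is u <= K, provided that K^(gam - q) ||u||_q^(q - 2) is small
    ([degiorgi]). As gam < q, it is small for K large, where K depends only on
    the bound for the norms of the solutions ([uniform_bound]). The bounds in L^r
    follow by interpolation between q and infinity.

    Continuity. Perturb u by t phi and by - t phi(. - z) and add the two
    quasi-minimality inequalities: by translation invariance of [.] this yields the
    Caccioppoli inequality for w = u(. + z) - u, with a constant that involves
    sup |u| only ([caccioppoli_shift]). Now K > 0 is fixed and smallness comes
    from ||w||_q, which tends to 0 with z: finiteness of [u] controls the modulus
    of continuity of u in L^2 ([shift_L2_continuous]), and u is bounded. Hence
    sup |u(. + z) - u| tends to 0 with z, and such a function agrees almost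
    everywhere with a continuous one ([continuous_representative]). *)

(** * Translations and cubes *)

Section translation.
Context (R : realType).

Lemma lebesgue_measure_shift (c : R) (A : set (measurableTypeR R)) :
  measurable A ->
  lebesgue_measure ((fun x : R => x + c) @^-1` A) = lebesgue_measure A.
Proof.
move=> mA.
have mc : measurable_fun setT (fun x : measurableTypeR R => x + c : measurableTypeR R).
  exact: measurable_funD.
pose nu := [the measure _ _ of pushforward (@lebesgue_measure R)
    (fun x : measurableTypeR R => x + c : measurableTypeR R)].
apply/esym; apply: (@lebesgue_measure_unique R (nu mc)) => // _ [[a b] _ <-].
rewrite /nu /= /pushforward.
rewrite [X in _ = lebesgue_measure X](_ : _ = `]a - c, b - c]%classic).
  rewrite !lebesgue_measure_itv/= !lte_fin ltrD2r.
  by case: ifP => // _; congr EFin; lra.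
by apply/seteqP; split => x; rewrite /= !in_itv/= ltrBlDr lerBrDr.
Qed.

Lemma measurable_shift_rV n (z : 'rV[R]_n) :
  measurable_fun setT (fun x : 'rV[R]_n => x + z).
Proof.
apply: measurable_fun_rV => i.
rewrite (_ : (fun _ => _) = (fun x : 'rV[R]_n => x 0 i + z 0 i)); last first.
  by apply/funext => x; rewrite mxE.
apply: (@measurable_funD _ _ R _ (fun x : 'rV[R]_n => x 0 i)) => //.
exact: measurable_coord_rV.
Qed.

(** Induction on the dimension: the section at x of a translated set is a
    translate of the section at x + z_0, and the outer one-dimensional integral
    absorbs the remaining shift. *)
Lemma lebesgue_rV_shift n (z : 'rV[R]_n) (A : set 'rV[R]_n) :
  measurable A ->
  lebesgue_rV R n ((fun x => x + z) @^-1` A) = lebesgue_rV R n A.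
Proof.
elim: n z A => [|n IHn] z A mA.
  congr (lebesgue_rV _ _ _); apply/seteqP.
  by split => x /=; rewrite (_ : x + z = x)//; apply/rowP => -[].
rewrite /= /lebesgue_rV_step /pushforward.
set B' := rV_cons (n:=n) @^-1` _; set B := rV_cons (n:=n) @^-1` A.
have mB : measurable B by rewrite -[B]setTI; exact: measurable_rV_cons.
pose z0 : measurableTypeR R := z 0 0.
pose z' := \row_i z 0 (lift ord0 i).
have mB' : measurable B'.
  rewrite /B' -[X in measurable X]setTI; apply: measurable_rV_cons => //.
  by rewrite -[X in measurable X]setTI; exact: measurable_shift_rV.
have B'E x : xsection B' x = (fun y => y + z') @^-1` xsection B (x + z0).
  apply/seteqP; split => y; rewrite /B'/B /xsection/= !inE/=;
  suff -> : rV_cons (x, y) + z = rV_cons (x + z0 : measurableTypeR R, y + z')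
    by []; apply/rowP => i; rewrite mxE; case: (unliftP ord0 i) => [j ->|->];
  by rewrite ?rV_consES ?rV_consE0 // !mxE.
rewrite /product_measure1 /=.
under eq_integral do rewrite B'E.
under eq_integral => x _.
  rewrite (IHn z' (xsection B (x + z0))); last exact: measurable_xsection.
  over.
have mphi := measurable_fun_xsection (lebesgue_rV R n) mB.
have mc : measurable_fun setT (fun x : measurableTypeR R => x + z0 : measurableTypeR R).
  exact: measurable_funD.
have := @ge0_integral_pushforward _ _ _ _ R _ mc (@lebesgue_measure R) setT _ measurableT
   (measurable_funTS mphi).
rewrite preimage_setT => <- //.
apply: eq_measure_integral => C mC _; exact: lebesgue_measure_shift.
Qed.

Lemma ge0_integral_shift n (z : 'rV[R]_n) (f : 'rV[R]_n -> \bar R) :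
  measurable_fun setT f -> (forall x, 0 <= f x)%E ->
  (\int[lebesgue_rV R n]_x f (x + z)%R = \int[lebesgue_rV R n]_x f x)%E.
Proof.
move=> mf f0.
have := @ge0_integral_pushforward _ _ _ _ R _ (measurable_shift_rV z) (lebesgue_rV R n) setT f measurableT mf.
rewrite preimage_setT => <- //.
apply: eq_measure_integral => [|mz C mC _]; first exact: measurable_shift_rV.
exact: lebesgue_rV_shift.
Qed.

Definition cube n (x : 'rV[R]_n) (r : R) : set 'rV[R]_n :=
  [set y | forall i, `|y 0 i - x 0 i| < r].

Lemma measurable_cube n x r : measurable (@cube n x r).
Proof.
rewrite (_ : cube x r = \bigcap_(i : 'I_n)
    ((fun y : 'rV[R]_n => y 0 i : measurableTypeR R) @^-1` (ball (x 0 i) r))).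
  apply: fin_bigcap_measurable => // i _.
  rewrite -[X in measurable X]setTI; apply: measurable_coord_rV => //.
  exact: measurable_ball.
apply/seteqP; split => [y yx i _|y yx i].
  by rewrite /= /ball /= distrC; exact: yx.
by have := yx i I; rewrite /= /ball /= distrC.
Qed.

Lemma lebesgue_rV_cube n x r : 0 <= r ->
  lebesgue_rV R n (cube x r) = ((2 * r) ^+ n)%:E.
Proof.
move=> r0.
have -> : cube x r = [set y | forall i : 'I_n,
    ball (x 0 i) r (y 0 i)].
  by apply/seteqP; split => y yx i; have := yx i; rewrite /ball/= distrC.
rewrite (@lebesgue_rV_box R n (fun i => ball (x 0 i) r)); last first.
  by move=> i; exact: measurable_ball.
under eq_bigr do rewrite lebesgue_measure_ball//.
by rewrite prodEFin prodr_const card_ord mulr_natl.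
Qed.

End translation.

(** * The kernel and the Gagliardo energy *)

Section kernel.
Context (R : realType) (N : nat).
Variable s : R.
Hypothesis (hs : 0 < s < 1) (hN : 2 * s < N%:R).
Local Notation V := 'rV[R]_N.
Local Notation mu := (lebesgue_rV R N).
Implicit Types (u v : V -> R).

Lemma measurable_enorm : measurable_fun setT (@enorm R N).
Proof.
rewrite /enorm.
rewrite (_ : (fun _ => _) = (fun t : R => t `^ 2^-1) \o (fun x : V => \sum_(i < N) x 0 i ^+ 2)).
  apply: measurableT_comp; first exact: measurable_powR.
  apply: measurable_sum => i; apply: measurable_funX.
  exact: measurable_coord_rV.
by apply/funext => x /=; rewrite powR12_sqrt// sumr_ge0// => i _; exact: sqr_ge0.
Qed.

Definition kernel (x : V) : R := (enorm x `^ (N%:R + 2 * s))^-1.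

Lemma kernel_ge0 x : 0 <= kernel x.
Proof. by rewrite invr_ge0 powR_ge0. Qed.

Lemma kernelN x : kernel (- x) = kernel x.
Proof.
congr (_ `^ _)^-1; congr Num.sqrt; apply: eq_bigr => i _.
by rewrite mxE sqrrN.
Qed.

Lemma measurable_kernel : measurable_fun setT kernel.
Proof.
rewrite (_ : kernel = (fun t : R => t `^ (-1)) \o (fun t : R => t `^ (N%:R + 2 * s)) \o @enorm R N).
  apply: measurableT_comp; last exact: measurable_enorm.
  by apply: measurableT_comp; exact: measurable_powR.
by apply/funext => x /=; rewrite powR_inv1// powR_ge0.
Qed.

Lemma enorm_gt0 (x : V) : x != 0 -> 0 < enorm x.
Proof.
move=> x0; rewrite sqrtr_gt0 lt0r sumr_ge0 ?andbT; last first.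
  by move=> i _; exact: sqr_ge0.
apply: contra x0 => /eqP H; apply/eqP/rowP => i; rewrite mxE.
apply/eqP; rewrite -sqrf_eq0; apply/eqP.
by apply: (psumr_eq0P _ H) => // j _; exact: sqr_ge0.
Qed.

Lemma enorm_cube (x y : V) r : 0 <= r -> cube x r y -> enorm (x - y) <= Num.sqrt N%:R * r.
Proof.
move=> r0 xy; rewrite -[r in leRHS]ger0_norm// -sqrtr_sqr -sqrtrM ?ler0n//.
rewrite ler_wsqrtr//; apply: (@le_trans _ _ (\sum_(i < N) r ^+ 2)).
  apply: ler_sum => i _; rewrite !mxE -sqrrN opprB -real_normK ?num_real//.
  by rewrite lerXn2r ?nnegrE// ltW// xy.
by rewrite sumr_const card_ord mulr_natl.
Qed.

(** The value of the kernel at the circumradius sqrt(N) r of a cube of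
    half-side r, hence its least value on that cube away from the centre. *)
Definition kernel_floor (r : R) : R := ((Num.sqrt N%:R * r) `^ (N%:R + 2 * s))^-1.

Lemma N_gt0 : 0 < N%:R :> R.
Proof. by move: hs => /andP[s0 _]; apply: lt_trans hN; rewrite mulr_gt0. Qed.

Lemma kernel_floor_gt0 r : 0 < r -> 0 < kernel_floor r.
Proof. by move=> r0; rewrite invr_gt0 powR_gt0// mulr_gt0// sqrtr_gt0 N_gt0. Qed.

(** The diagonal is excluded because the kernel takes there the junk value
    0 = 0^-1. *)
Lemma le_kernel_floor x y r : x != y -> 0 <= r -> cube x r y ->
  kernel_floor r <= kernel (x - y).
Proof.
move=> xy r0 xry; rewrite lef_pV2 ?posrE.
- apply: ge0_ler_powR; rewrite ?nnegrE.
  + by rewrite addr_ge0// mulr_ge0// ltW//; case/andP: hs.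
  + exact: sqrtr_ge0.
  + by rewrite mulr_ge0// sqrtr_ge0.
  + exact: enorm_cube.
- rewrite powR_gt0// (lt_le_trans _ (enorm_cube r0 xry))// enorm_gt0//.
  by rewrite subr_eq0.
- by rewrite powR_gt0// enorm_gt0// subr_eq0.
Qed.

Definition diffquot u (z : V * V) : R := (u z.1 - u z.2) ^+ 2 * kernel (z.1 - z.2).

Lemma diffquot_ge0 u z : 0 <= diffquot u z.
Proof. by rewrite mulr_ge0 ?sqr_ge0 ?kernel_ge0. Qed.

Lemma measurable_sub_rV : measurable_fun setT (fun z : V * V => z.1 - z.2).
Proof.
apply: measurable_fun_rV => i.
rewrite (_ : (fun _ => _) = (fun z : V * V => z.1 0 i - z.2 0 i)); last first.
  by apply/funext => x; rewrite !mxE.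
apply: (@measurable_funB _ _ R _ (fun z : V * V => z.1 0 i) (fun z : V * V => z.2 0 i)).
  exact: (measurableT_comp (measurable_coord_rV i)).
exact: (measurableT_comp (measurable_coord_rV i)).
Qed.

Lemma measurable_add_rV : measurable_fun setT (fun z : V * V => z.1 + z.2).
Proof.
apply: measurable_fun_rV => i.
rewrite (_ : (fun _ => _) = (fun z : V * V => z.1 0 i + z.2 0 i)); last first.
  by apply/funext => x; rewrite !mxE.
apply: (@measurable_funD _ _ R _ (fun z : V * V => z.1 0 i) (fun z : V * V => z.2 0 i)).
  exact: (measurableT_comp (measurable_coord_rV i)).
exact: (measurableT_comp (measurable_coord_rV i)).
Qed.

Lemma measurable_diffquot u : measurable_fun setT u -> measurable_fun setT (diffquot u).
Proof.
move=> mu_; apply: measurable_funM.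
  apply: measurable_funX; apply: measurable_funB.
    exact: (measurableT_comp mu_).
  exact: (measurableT_comp mu_).
by apply: (measurableT_comp measurable_kernel); exact: measurable_sub_rV.
Qed.

Local Open Scope ereal_scope.

Definition dirichlet u : \bar R := \int[mu \x mu]_z (diffquot u z)%:E.

Lemma gagliardoE u : gagliardo s u = dirichlet u `^ 2^-1.
Proof. by []. Qed.

Lemma dirichlet_ge0 u : 0 <= dirichlet u.
Proof. by apply: integral_ge0 => z _; rewrite lee_fin diffquot_ge0. Qed.

Lemma dirichletE u : measurable_fun setT u ->
  dirichlet u = \int[mu]_x \int[mu]_y (diffquot u (x, y))%:E.
Proof.
move=> mf; rewrite /dirichlet fubini_tonelli1//.
  by apply/measurable_EFinP; exact: measurable_diffquot.
by move=> z; rewrite lee_fin diffquot_ge0.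
Qed.

Lemma dirichlet_fin u : dirichlet u < +oo ->
  exists2 d : R, (0 <= d)%R & dirichlet u = d%:E.
Proof.
move=> Du; exists (fine (dirichlet u)); first by rewrite fine_ge0// dirichlet_ge0.
by rewrite fineK// ge0_fin_numE// dirichlet_ge0.
Qed.

Definition energy_density u x := \int[mu]_y (diffquot u (x, y))%:E.

Lemma measurable_energy_density u : measurable_fun setT u ->
  measurable_fun setT (energy_density u).
Proof.
move=> mf.
apply: (@measurable_fun_fubini_tonelli_F _ _ _ _ _ mu (EFin \o diffquot u)).
  by apply/measurable_EFinP; exact: measurable_diffquot.
by move=> z; rewrite lee_fin diffquot_ge0.
Qed.

End kernel.

(** * The Sobolev inequality *)

Lemma le_integral_set d (T : measurableType d) (R : realType)
    (mu : {measure set T -> \bar R}) (B : set T) (f : T -> \bar R) (a : \bar R) :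
  measurable B -> measurable_fun setT f -> (forall x, 0 <= f x)%E ->
  (0 <= a)%E -> (forall x, B x -> a <= f x)%E ->
  (a * mu B <= \int[mu]_x f x)%E.
Proof.
move=> mB mf f0 a0 af.
rewrite -integral_cst//.
apply: (@le_trans _ _ (\int[mu]_(x in B) f x)%E).
  by apply: ge0_le_integral => //; exact: measurable_funTS.
exact: ge0_subset_integral.
Qed.

Lemma powR_expR (R : realType) (x p : R) : 0 < x -> x `^ p = expR (p * ln x).
Proof. by move=> x0; rewrite /powR gt_eqF. Qed.

Section sobolev.
Context (R : realType) (N : nat).
Variable s : R.
Hypothesis (hs : 0 < s < 1) (hN : 2 * s < N%:R).
Local Notation V := 'rV[R]_N.
Local Notation mu := (lebesgue_rV R N).
Local Notation q := (critical_exponent N s).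
Implicit Types (u v : V -> R).

Lemma critical_exponent_gt2 : 2 < q.
Proof.
have N0 := N_gt0 hs hN; case/andP: hs => s0 _.
by rewrite /critical_exponent ltr_pdivlMr ?subr_gt0//; lra.
Qed.

Lemma critical_exponent_gt0 : 0 < q.
Proof. exact: lt_trans critical_exponent_gt2. Qed.

Definition int_pow (p : R) v : \bar R := (\int[mu]_x (`|v x| `^ p)%:E)%E.

Lemma measurable_pow_norm (p : R) v : measurable_fun setT v ->
  measurable_fun setT (fun x => `|v x| `^ p).
Proof.
move=> mv; apply: (measurableT_comp (measurable_powR p)).
exact: measurableT_comp.
Qed.

Lemma int_pow_ge0 p v : (0 <= int_pow p v)%E.
Proof. by apply: integral_ge0 => x _; rewrite lee_fin powR_ge0. Qed.

Definition sobolev_const : R :=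
  8 * (Num.sqrt N%:R / 2) `^ (N%:R + 2 * s) * (2 `^ (q + 1)) `^ (2 * s / N%:R).

Lemma sobolev_const_gt0 : 0 < sobolev_const.
Proof.
have N0 := N_gt0 hs hN.
by rewrite !mulr_gt0// !powR_gt0// divr_gt0// sqrtr_gt0.
Qed.

(** The radius r is that of a cube of volume t = 2 (2^q A / l^q). Up to
    constants the right-hand side is then A^(2s/N) l^2 t^(-2s/N), which has the
    homogeneity l^(2 + 2sq/N) = l^q; the identity is linear in the logarithms. *)
Lemma sobolev_scaling (l A : R) (r := (2 * (2 `^ q * A / l `^ q)) `^ N%:R^-1 / 2) :
  0 < l -> 0 < A ->
  l `^ q = sobolev_const * A `^ (2 * s / N%:R) *
    (l ^+ 2 / 4 * kernel_floor N s r * (2 * (2 `^ q * A / l `^ q) / 2)).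
Proof.
move=> l0 A0; have N0 := N_gt0 hs hN; have s0 : 0 < s by case/andP: hs.
have c0 : 0 < Num.sqrt N%:R / 2 :> R by rewrite divr_gt0// sqrtr_gt0.
pose k := ln (2 : R); pose a := ln A; pose b := ln l; pose c := ln (Num.sqrt N%:R / 2 : R).
pose tau := (q + 1) * k + a - q * b.
have tE : 2 * (2 `^ q * A / l `^ q) = expR tau.
  rewrite /tau (mulrDl q 1 k) mul1r expRD expRN expRD expRD !powR_expR//.
  by rewrite /a /b /k !lnK ?posrE//; ring.
rewrite (_ : kernel_floor N s _ = expR (- ((c + tau / N%:R) * (N%:R + 2 * s)))); last first.
  rewrite /kernel_floor /r expRN expRM expRD tE.
  by rewrite -expRM mulrCA mulrC /c lnK// mulrA.
rewrite tE /sobolev_const.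
rewrite (_ : 8 * _ * _ * _ * _ = (Num.sqrt N%:R / 2) `^ (N%:R + 2 * s) *
  (2 `^ (q + 1)) `^ (2 * s / N%:R) * A `^ (2 * s / N%:R) * l ^+ 2 *
  expR (- ((c + tau / N%:R) * (N%:R + 2 * s))) * expR tau); last by field.
rewrite -(@powR_mulrn _ l) ?ltW// -powRrM !powR_expR// -/a -/b -/k -/c.
rewrite -!expRD; congr expR.
rewrite /tau /critical_exponent; field.
by rewrite !gt_eqF// subr_gt0.
Qed.

(** With l = |v(x)|, Chebyshev bounds the measure of the set where |v| >= l/2 by
    2^q A / l^q. On a cube around x of twice that volume, at least half of the
    points y therefore satisfy |v(x) - v(y)| >= l/2, and each of them contributes
    to the energy density at x at least l^2/4 times the least value of the
    kernel. *)
Lemma sobolev_pointwise v (A : R) x : measurable_fun setT v ->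
  0 < A -> int_pow q v = A%:E ->
  ((`|v x| `^ q)%:E <=
    (sobolev_const * A `^ (2 * s / N%:R))%:E * energy_density s v x)%E.
Proof.
move=> mv A0 Av; have q0 := critical_exponent_gt0; have N0 := N_gt0 hs hN.
have C0 := sobolev_const_gt0.
have E0 : (0 <= energy_density s v x)%E.
  by apply: integral_ge0 => y _; rewrite lee_fin diffquot_ge0.
have [->|vx0] := eqVneq (v x) 0.
  rewrite normr0 powR0 ?gt_eqF// mule_ge0// lee_fin mulr_ge0 ?powR_ge0//.
  exact: ltW.
set l := `|v x|; have l0 : 0 < l by rewrite normr_gt0.
(* t is the volume of the cube: twice the Chebyshev bound *)
pose t := 2 * (2 `^ q * A / l `^ q).
have t0 : 0 < t by rewrite mulr_gt0// divr_gt0 ?mulr_gt0 ?powR_gt0.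
pose r := t `^ N%:R^-1 / 2.
have r0 : 0 < r by rewrite divr_gt0 ?powR_gt0.
have rt : (2 * r) ^+ N = t.
  rewrite /r mulrCA divff ?mulr1// -powR_mulrn ?powR_ge0// -powRrM mulVf ?gt_eqF//.
  by rewrite powRr1// ltW.
pose B := [set y | (l / 2) `^ q <= `|v y| `^ q].
have mB : measurable B.
  have := measurable_pow_norm q mv => /(_ measurableT `[((l / 2) `^ q), +oo[%classic).
  rewrite setTI preimage_itvcy; apply; exact: measurable_itv.
have muB : (mu B <= (t / 2)%:E)%E.
  have := @le_integral_set _ _ _ mu B (fun y => (`|v y| `^ q)%:E) ((l / 2) `^ q)%:E mB.
  rewrite -/(int_pow q v) Av => H.
  have {}H : (((l / 2) `^ q)%:E * mu B <= A%:E)%E.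
    apply: H => //.
    - by apply/measurable_EFinP; exact: measurable_pow_norm.
    - by rewrite lee_fin powR_ge0.
  rewrite -lee_pdivlMl ?powR_gt0 ?divr_gt0// in H.
  apply: (le_trans H); rewrite -EFinM lee_fin /t.
  rewrite powRM ?invr_ge0 ?(ltW l0)// -[2^-1](@powR_inv1 _ 2)// -powRrM mulN1r powRN.
  rewrite invfM invrK le_eqVlt; apply/orP; left; apply/eqP.
  have : l `^ q != 0 by rewrite gt_eqF// powR_gt0.
  by move=> ?; rewrite powR_inv1//; field.
pose K := cube x r.
have mK : measurable K by exact: measurable_cube.
have muK : mu K = t%:E by rewrite lebesgue_rV_cube ?rt// ltW.
have muKB : ((t / 2)%:E <= mu (K `\` B))%E.
  have H1 : (t%:E <= mu (K `\` B) + mu B)%E.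
    rewrite -muK; apply: (@le_trans _ _ (mu ((K `\` B) `|` B))); last first.
      by apply: measureU2 => //; exact: measurableD.
    apply: le_measure; rewrite ?inE//; first by apply: measurableU => //; exact: measurableD.
    by move=> y Ky; case: (pselect (B y)); [right|left].
  have {}H1 := le_trans H1 (leeD2l _ muB).
  rewrite -(@leeD2rE _ (t / 2)%:E)//; apply: le_trans H1.
  by rewrite -EFinD lee_fin; lra.
have Eden : ((l ^+ 2 / 4 * kernel_floor N s r)%:E * (t / 2)%:E <= energy_density s v x)%E.
  apply: (@le_trans _ _ ((l ^+ 2 / 4 * kernel_floor N s r)%:E * mu (K `\` B))%E).
    by rewrite lee_pmul2l// lte_fin !mulr_gt0// ?exprn_gt0//; exact: kernel_floor_gt0.
  apply: le_integral_set => //.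
  - exact: measurableD.
  - apply/measurable_EFinP.
    apply: (measurableT_comp (measurable_diffquot s mv)).
    exact: measurable_pair1.
  - by move=> y; rewrite lee_fin diffquot_ge0.
  - by rewrite lee_fin mulr_ge0 ?divr_ge0 ?sqr_ge0// (ltW (kernel_floor_gt0 hs hN r0)).
  - move=> y [Ky /negP]; rewrite -ltNge => By.
    have vy : `|v y| < l / 2.
      rewrite ltNge; apply: contraL By => vy; rewrite -leNgt.
      by apply: ge0_ler_powR; rewrite ?nnegrE// ltW// divr_gt0.
    have xy : x != y by apply/eqP => xy; move: vy; rewrite -xy -/l; lra.
    rewrite lee_fin /diffquot/=; apply: ler_pM => //.
    + by rewrite mulr_ge0 ?sqr_ge0.
    + exact: (ltW (kernel_floor_gt0 hs hN r0)).
    + rewrite -(real_normK (num_real (v x - v y))).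
      rewrite (_ : l ^+ 2 / 4 = (l / 2) ^+ 2); last by field.
      have : l / 2 <= `|v x - v y|.
        by apply: le_trans (lerB_dist _ _); rewrite -/l; lra.
      by move=> h; rewrite lerXn2r ?nnegrE// ltW// divr_gt0.
    + by apply: le_kernel_floor => //; exact: ltW.
apply: le_trans (lee_wpmul2l _ Eden); last first.
  by rewrite lee_fin mulr_ge0 ?powR_ge0// ltW.
rewrite -!EFinM lee_fin le_eqVlt; apply/orP; left; apply/eqP.
exact: sobolev_scaling.
Qed.


Local Open Scope ereal_scope.

(** Integrating the pointwise bound gives A <= C A^(2s/N) [v]^2 where A is the
    integral of |v|^q, and 1 - 2s/N = 2/q. Finiteness of A is what allows the
    division. *)
Theorem sobolev : exists2 C : R, (0 < C)%R & forall v,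
  measurable_fun setT v -> int_pow q v < +oo ->
  int_pow q v `^ (2 / q) <= C%:E * dirichlet s v.
Proof.
exists sobolev_const => [|v mv]; first exact: sobolev_const_gt0.
have := int_pow_ge0 q v; rewrite le_eqVlt => /predU1P[<- _|].
  rewrite poweR0r; first by rewrite mule_ge0 ?dirichlet_ge0// lee_fin ltW// sobolev_const_gt0.
  by rewrite gt_eqF// divr_gt0// critical_exponent_gt0.
case E : (int_pow q v) => [A| |]//; rewrite lte_fin => A0 _.
have N0 := N_gt0 hs hN; have q2 := critical_exponent_gt2.
have : A%:E <= (sobolev_const * A `^ (2 * s / N%:R))%:E * dirichlet s v.
  rewrite dirichletE// -ge0_integralZl_EFin//; last 3 first.
  - by move=> x _; apply: integral_ge0 => y _; rewrite lee_fin diffquot_ge0.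
  - exact: measurable_energy_density.
  - by rewrite mulr_ge0 ?powR_ge0// ltW// sobolev_const_gt0.
  rewrite -[leLHS]E; apply: ge0_le_integral => //.
  - by apply/measurable_EFinP; exact: measurable_pow_norm.
  - by apply: measurable_funeM; exact: measurable_energy_density.
  - by move=> x _; exact: sobolev_pointwise.
rewrite (mulrC sobolev_const) EFinM -muleA -lee_pdivrMl ?powR_gt0//.
apply: le_trans; rewrite -EFinM lee_fin le_eqVlt; apply/orP; left; apply/eqP.
rewrite -powRN -[X in _ = (_ * X)%R]powRr1 ?ltW// -powRD; last first.
  by rewrite (gt_eqF A0) implybT.
congr (_ `^ _)%R; rewrite /critical_exponent.
by field; rewrite !gt_eqF// subr_gt0.
Qed.

End sobolev.

(** * De Giorgi iteration *)

Lemma ler_powR2r (R : realType) (p x y : R) : 0 < p -> 0 <= x -> 0 <= y ->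
  (x `^ p <= y `^ p) = (x <= y).
Proof.
move=> p0 x0 y0; apply/idP/idP => [|xy]; last first.
  by apply: ge0_ler_powR; rewrite ?nnegrE// ltW.
by apply: contraTT; rewrite -!ltNge => yx; apply: gt0_ltr_powR; rewrite ?nnegrE.
Qed.

(** The recursion improves the power of Y_n from th < 1 to 1, which beats the
    geometric factor: if Y_n <= b^(-n) Y_0, then the factors b^((1 - th) n) and
    b^(-n) combine to b^(- th n), and the smallness of Y_0 pays for one more
    factor b^(- th). *)
Lemma fast_decay (R : realType) (th b a : R) (Y : nat -> R) :
  0 < th < 1 -> 1 < b -> 0 <= a -> (forall n, 0 <= Y n) ->
  (forall n, Y n.+1 `^ th <= a * (b `^ (1 - th)) ^+ n * Y n) ->
  a * b `^ th * Y 0%N `^ (1 - th) <= 1 ->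
  forall n, Y n <= (b^-1) ^+ n * Y 0%N.
Proof.
move=> /andP[th0 th1] b1 a0 Y0 Yrec Ysmall; have b0 : 0 < b by exact: lt_trans b1.
elim=> [|n IH]; first by rewrite expr0 mul1r.
have bn0 m : 0 <= (b^-1) ^+ m by rewrite exprn_ge0// invr_ge0 ltW.
rewrite -(@ler_powR2r _ th)//; last by rewrite mulr_ge0.
apply: (le_trans (Yrec n)).
apply: (@le_trans _ _ (a * (b `^ (1 - th)) ^+ n * ((b^-1) ^+ n * Y 0%N))).
  by rewrite ler_wpM2l// mulr_ge0// exprn_ge0// powR_ge0.
have YE : Y 0%N = Y 0%N `^ (1 - th) * Y 0%N `^ th.
  rewrite -powRD ?subrK ?powRr1//.
  by rewrite oner_eq0.
have bE m : (b^-1) ^+ m = b `^ (- m%:R).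
  by rewrite powRN powR_mulrn ?(ltW b0)// exprVn.
rewrite powRM// {1}YE !bE -powR_mulrn ?powR_ge0// -!powRrM.
rewrite (_ : _ * _ = (a * b `^ th * Y 0%N `^ (1 - th)) *
    (b `^ (- n.+1%:R * th) * Y 0%N `^ th)).
  by rewrite ler_piMl// mulr_ge0 ?powR_ge0.
rewrite !mulrA; congr (_ * _); rewrite [RHS]mulrAC; congr (_ * _).
rewrite -!mulrA; congr (_ * _).
rewrite -!powRD ?(gt_eqF b0) ?implybT//.
by congr (_ `^ _); rewrite -natr1; ring.
Qed.

Section degiorgi.
Context (R : realType) (N : nat).
Variable s : R.
Hypothesis (hs : 0 < s < 1) (hN : 2 * s < N%:R).
Local Notation V := 'rV[R]_N.
Local Notation mu := (lebesgue_rV R N).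
Local Notation q := (critical_exponent N s).
Implicit Types (u v w : V -> R).

Definition excess (k : R) w : V -> R := fun x => Num.max 0 (w x - k).

Lemma excess_ge0 k w x : 0 <= excess k w x.
Proof. by rewrite le_max lexx. Qed.

Lemma measurable_excess k w : measurable_fun setT w -> measurable_fun setT (excess k w).
Proof.
by move=> mw; apply: measurable_maxr => //; exact: measurable_funB.
Qed.

Lemma excess_le k w x : 0 <= k -> excess k w x <= `|w x|.
Proof.
move=> k0; rewrite ge_max normr_ge0/= lerBlDr.
by rewrite (le_trans (ler_norm _))// lerDl.
Qed.

Lemma int_pow_le p u v : 0 <= p -> measurable_fun setT u -> measurable_fun setT v ->
  (forall x, `|u x| <= `|v x|) -> (int_pow p u <= int_pow p v)%E.
Proof.
move=> p0 mu_ mv uv; apply: ge0_le_integral => //.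
- by apply/measurable_EFinP; exact: measurable_pow_norm.
- by apply/measurable_EFinP; exact: measurable_pow_norm.
- by move=> x _; rewrite lee_fin; apply: ge0_ler_powR; rewrite ?nnegrE.
Qed.

(** Write m for the excess of t over the level of index n. Where t exceeds the
    next level, m >= K / 2^(n + 1), so that r = 2^(n + 2) m / K is at least 2
    and dominates both t / K and the excess over the next level divided by K.
    As r >= 1, the powers r and r^gam can then be raised to r^q. *)
Lemma degiorgi_pointwise gam K (n : nat) (t : R) :
  1 < gam <= q -> 0 < K ->
  Num.max 0 (t - K * (1 - 2^-1 ^+ n.+1)) * (1 + `|t| `^ (gam - 1)) <=
  (K + K `^ gam) * K `^ (- q) * (2 `^ q) ^+ n.+2 *
    Num.max 0 (t - K * (1 - 2^-1 ^+ n)) `^ q.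
Proof.
move=> /andP[g1 gq] K0.
have q0 := critical_exponent_gt0 hs hN.
have rhs0 (m : R) : 0 <= (K + K `^ gam) * K `^ (- q) * (2 `^ q) ^+ n.+2 * m `^ q.
  rewrite mulr_ge0 ?powR_ge0// mulr_ge0 ?exprn_ge0 ?powR_ge0// mulr_ge0 ?powR_ge0//.
  by rewrite addr_ge0 ?powR_ge0// ltW.
set d := 2^-1 ^+ n; have d0 : 0 < d by rewrite exprn_gt0.
have d1 : d <= 1 by rewrite exprn_ile1// invf_le1// ler1n.
have dS : 2^-1 ^+ n.+1 = d / 2 by rewrite exprS mulrC.
rewrite dS.
have [h|h] := leP (t - K * (1 - d / 2)) 0; first by rewrite mul0r.
have Kd : 0 < K * d by rewrite mulr_gt0.
have KdK : K * d <= K by rewrite ler_piMr// ltW.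
have h1 : K * d / 2 < t - K * (1 - d) by lra.
have t0 : 0 < t by lra.
rewrite max_r; last by lra.
set m := t - K * (1 - d) in h1 *; have m0 : 0 < m by lra.
pose r := 4 * m / (K * d).
have r2 : 2 <= r by rewrite /r ler_pdivlMr//; lra.
have r0 : 0 < r by lra.
have mE : m = r * K * d / 4 by rewrite /r; field; rewrite !gt_eqF.
have tr : t <= K * r.
  have : t <= m + K by rewrite /m; lra.
  move=> /le_trans; apply.
  have : m <= K * r / 4 by rewrite mE; nra.
  nra.
have mr : t - K * (1 - d / 2) <= r * K.
  apply: (@le_trans _ _ m); first by rewrite /m; lra.
  by rewrite mE; nra.
rewrite gtr0_norm//.
rewrite -[leRHS]mulrA.
have -> : (2 `^ q) ^+ n.+2 * m `^ q = r `^ q * K `^ q.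
  have -> : (2 `^ q) ^+ n.+2 = (2 ^+ n.+2) `^ q :> R.
    by rewrite -[LHS]powR_mulrn ?powR_ge0// -powRrM mulrC powRrM powR_mulrn.
  rewrite -!powRM ?ltW ?exprn_gt0//; congr (_ `^ _).
  rewrite mE (_ : 2 ^+ n.+2 = 4 / d :> R); first by field; rewrite gt_eqF.
  by rewrite /d exprVn invrK !exprS; ring.
have -> : (K + K `^ gam) * K `^ (- q) * (r `^ q * K `^ q) = (K + K `^ gam) * r `^ q.
  rewrite powRN; field; exact/lt0r_neq0/powR_gt0.
have r1 : 1 <= r by apply: le_trans r2; rewrite ler1n.
apply: (@le_trans _ _ (r * K * (1 + (r * K) `^ (gam - 1)))).
  apply: ler_pM => //; [lra|by rewrite addr_ge0 ?powR_ge0|].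
  rewrite lerD2l; apply: ge0_ler_powR; rewrite ?nnegrE; [lra|exact: ltW| |].
    by rewrite mulr_ge0 ?ltW.
  by rewrite mulrC.
rewrite mulrDr mulr1 mulr_powRB1; [|by rewrite mulr_ge0 ?ltW|lra].
rewrite powRM ?(ltW r0) ?(ltW K0)// [leRHS]mulrDl; apply: lerD; rewrite mulrC.
  by rewrite ler_pM2l// le1r_powR//; lra.
by rewrite ler_pM2l ?powR_gt0// ler_powR.
Qed.

Local Open Scope ereal_scope.

Lemma int_pow_eq0_ae p v : (0 < p)%R -> measurable_fun setT v -> int_pow p v = 0 ->
  \forall x \ae mu, v x = 0%R.
Proof.
move=> p0 mv v0.
have mp : measurable_fun setT (fun x => (`|v x| `^ p)%:E).
  by apply/measurable_EFinP; exact: measurable_pow_norm.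
have := @ae_eq_integral_abs _ _ _ mu setT measurableT _ mp.
case=> + _; move=> H; have {}H : ae_eq mu setT (fun x => (`|v x| `^ p)%:E) (cst 0).
  apply: H; rewrite -[RHS]v0; apply: eq_integral => x _.
  by rewrite gee0_abs// lee_fin powR_ge0.
apply: filterS H => x /(_ I) [] /powR_eq0_eq0 /eqP; by rewrite normr_eq0 => /eqP.
Qed.

(** The condition has two regimes. For fixed A it holds as soon as K is large,
    because gam < q makes K^(gam - q) small; for fixed K it holds as soon as A is
    small. *)
Theorem degiorgi : exists2 c0 : R, (0 < c0)%R & forall w gam M K A,
  measurable_fun setT w -> (1 < gam <= q)%R -> (0 <= M)%R ->
  (0 < K)%R -> int_pow q w <= A%:E ->
  (forall k, (0 < k)%R -> dirichlet s (excess k w) <=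
     \int[mu]_x (M * (excess k w x * (1 + `|w x| `^ (gam - 1))))%:E) ->
  (M * ((K + K `^ gam) * K `^ (- q)) * A `^ (1 - 2 / q) <=
    c0)%R ->
  \forall x \ae mu, (w x <= K)%R.
Proof.
have q2 := critical_exponent_gt2 hs hN; have q0 := critical_exponent_gt0 hs hN.
have [S S0 sobolevS] := sobolev hs hN.
pose c1 : R := (S * (2 `^ q) ^+ 2 * (2 `^ q) `^ ((2 / q) / (1 - 2 / q)))%R.
have c10 : (0 < c1)%R.
  by rewrite mulr_gt0 ?powR_gt0// mulr_gt0 ?exprn_gt0 ?powR_gt0.
exists c1^-1%R => [|w gam M K A mw gq M0 K0 wA caccioppoli small].
  by rewrite invr_gt0.
(* The level of index 0 is 0, so that the energy bound, available for positive
   levels, is applied at the levels of index n + 1. *)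
pose k n : R := (K * (1 - 2^-1 ^+ n))%R.
pose wn n := excess (k n) w.
have k0 n : (0 <= k n)%R.
  by rewrite mulr_ge0 ?(ltW K0)// subr_ge0 exprn_ile1// invf_le1// ler1n.
have kS0 n : (0 < k n.+1)%R.
  rewrite mulr_gt0// subr_gt0; apply: exprn_ilt1 => //; by rewrite invf_lt1// ltr1n.
have mwn n : measurable_fun setT (wn n) by exact: measurable_excess.
have wnw n : int_pow q (wn n) <= int_pow q w.
  apply: int_pow_le => //; first exact: ltW.
  by move=> x; rewrite ger0_norm ?excess_ge0// excess_le.
have wnoo n : int_pow q (wn n) < +oo.
  by apply: le_lt_trans (wnw n) (le_lt_trans wA _); rewrite ltry.
have [Y YE] : exists Y : nat -> R, forall n, int_pow q (wn n) = (Y n)%:E.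
  exists (fun n => fine (int_pow q (wn n))) => n.
  by rewrite fineK// ge0_fin_numE// int_pow_ge0.
have Y0 n : (0 <= Y n)%R by rewrite -lee_fin -YE int_pow_ge0.
set c := (M * ((K + K `^ gam) * K `^ (- q)))%R in small.
have cge0 : (0 <= c)%R.
  by rewrite mulr_ge0// mulr_ge0 ?powR_ge0// addr_ge0 ?powR_ge0// ltW.
set th := (2 / q)%R in small.
have th01 : (0 < th < 1)%R by rewrite /th divr_gt0//= ltr_pdivrMr// mul1r.
(* chosen so that b^(1 - th) is the ratio 2^q of the recursion *)
pose b := ((2 `^ q) `^ (1 - th)^-1)%R.
have b1 : (1 < b)%R.
  rewrite /b -powRrM -[ltLHS](@powRr0 _ 2) /powR !gt_eqF// ltr_expR.
  rewrite ltr_pM2r ?ln_gt0 ?ltr1n// mulr_gt0// invr_gt0; lra.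
have bth : (b `^ (1 - th) = 2 `^ q)%R.
  by rewrite /b -powRrM mulVf ?powRr1 ?powR_ge0//; lra.
pose a := (S * c * (2 `^ q) ^+ 2)%R.
have a0 : (0 <= a)%R by rewrite mulr_ge0 ?exprn_ge0 ?powR_ge0// mulr_ge0// ltW.
have Yrec n : (Y n.+1 `^ th <= a * (b `^ (1 - th)) ^+ n * Y n)%R.
  rewrite bth -lee_fin -poweR_EFin -YE.
  apply: (le_trans (sobolevS _ (mwn n.+1) (wnoo n.+1))).
  have -> : (a * (2 `^ q) ^+ n * Y n =
      S * (c * (2 `^ q) ^+ n.+2 * Y n))%R.
    by rewrite /a !exprS; ring.
  rewrite [leRHS]EFinM lee_pmul2l ?lte_fin//.
  apply: (le_trans (caccioppoli _ (kS0 n))).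
  rewrite [leRHS]EFinM -YE -ge0_integralZl_EFin//; last 2 first.
  - by apply/measurable_EFinP; exact: measurable_pow_norm.
  - by rewrite mulr_ge0 ?exprn_ge0 ?powR_ge0.
  apply: ge0_le_integral => //.
  - by move=> x _; rewrite lee_fin !mulr_ge0 ?addr_ge0 ?powR_ge0 ?excess_ge0.
  - apply/measurable_EFinP; apply: measurable_funM => //.
    apply: measurable_funM; first exact: mwn.
    by apply: measurable_funD => //; exact: measurable_pow_norm.
  - apply: measurable_funeM; apply/measurable_EFinP; exact: measurable_pow_norm.
  move=> x _; rewrite -EFinM lee_fin.
  rewrite (_ : c * _ * _ = M * ((K + K `^ gam) * K `^ (- q) * (2 `^ q) ^+ n.+2 *
    `|wn n x| `^ q))%R; last by rewrite /c !mulrA.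
  rewrite ler_wpM2l// [`|wn n x|%R]ger0_norm ?excess_ge0//.
  exact: (degiorgi_pointwise n (w x) gq K0).
have Ysmall : (a * b `^ th * Y 0%N `^ (1 - th) <= 1)%R.
  apply: (@le_trans _ _ (c1 * (c * A `^ (1 - th)))%R).
    rewrite [leLHS](_ : _ = c1 * (c * Y 0%N `^ (1 - th)))%R; last first.
      have -> : (b `^ th = (2 `^ q) `^ (th / (1 - th)))%R.
        by rewrite /b -[LHS]powRrM mulrC.
      by rewrite /c1 -/th /a; ring.
    rewrite ler_wpM2l ?(ltW c10)// ler_wpM2l//.
    have YA : (Y 0%N <= A)%R by rewrite -lee_fin -YE (le_trans (wnw 0%N)).
    apply: ge0_ler_powR; rewrite ?nnegrE//; first lra.
    exact: le_trans YA.
  by rewrite -ler_pdivlMl// mulr1.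
have decay := fast_decay th01 b1 a0 Y0 Yrec Ysmall.
have excess0 : int_pow q (excess K w) = 0.
  apply/eqP; rewrite eq_le int_pow_ge0 andbT.
  apply/lee_addgt0Pr => e e0; rewrite add0e.
  have : ((b^-1) ^+ n * Y 0%N @[n --> \oo] --> (0 : R))%R.
    rewrite -(mul0r (Y 0%N)); apply: cvgMl; apply: cvg_expr.
    by rewrite ger0_norm ?invr_ge0 ?invf_lt1// ?(ltW (lt_trans ltr01 b1))// (lt_trans ltr01 b1).
  move=> /cvgrPdist_lt /(_ _ e0) [n _ /(_ n (leqnn n))] /=.
  rewrite sub0r normrN ger0_norm; last first.
    by rewrite mulr_ge0// exprn_ge0// invr_ge0 ltW// (lt_trans ltr01 b1).
  move=> bn; apply: (@le_trans _ _ (int_pow q (wn n))).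
    apply: int_pow_le => //; [exact: ltW|exact: measurable_excess|].
    move=> x; rewrite !ger0_norm ?excess_ge0// /wn /excess ge_max le_max lexx/=.
    rewrite le_max lerB ?orbT// /k ler_piMr ?(ltW K0)// gerBl exprn_ge0// invr_ge0.
  by rewrite YE lee_fin (le_trans (decay n))// ltW.
have := int_pow_eq0_ae q0 (measurable_excess K mw) excess0.
apply: filterS => x; rewrite /excess => wx.
by rewrite -subr_le0 -wx le_max lexx orbT.
Qed.
End degiorgi.

(** * The homogeneous fractional Sobolev space *)

Section Hdot_facts.
Context (R : realType) (N : nat).
Variable s : R.
Hypothesis (hs : 0 < s < 1) (hN : 2 * s < N%:R).
Local Notation V := 'rV[R]_N.
Local Notation mu := (lebesgue_rV R N).
Local Notation q := (critical_exponent N s).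
Implicit Types (u v w : V -> R).
Local Open Scope ereal_scope.

Lemma LnormE p u : 'N[mu]_p%:E[EFin \o u] = int_pow p u `^ p^-1.
Proof. by rewrite unlock. Qed.

Lemma HdotP u : Hdot s u <->
  [/\ measurable_fun setT u, dirichlet s u < +oo & int_pow q u < +oo].
Proof.
have q0 := critical_exponent_gt0 hs hN.
rewrite /Hdot /= /Hdot_norm gagliardoE LnormE; split.
  move=> [mu_ H]; split => //.
    apply: (@lty_poweRy _ _ 2^-1) => //.
    by apply: le_lt_trans H; rewrite leeDl ?poweR_ge0.
  apply: (@lty_poweRy _ _ q^-1); first by rewrite invr_neq0// gt_eqF.
  by apply: le_lt_trans H; rewrite leeDr ?poweR_ge0.
move=> [mu_ Du Lu]; split => //.
by apply: lte_add_pinfty; exact: poweR_lty.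
Qed.

Lemma Hdot_norm_ge0 u : 0 <= Hdot_norm s u.
Proof. by rewrite /Hdot_norm gagliardoE adde_ge0 ?poweR_ge0 ?Lnorm_ge0. Qed.

Lemma int_pow_le_Hdot_norm (D : R) u : (0 <= D)%R -> Hdot_norm s u <= D%:E ->
  int_pow q u <= (D `^ q)%:E.
Proof.
have q0 := critical_exponent_gt0 hs hN.
move=> D0 uD; have h : int_pow q u `^ q^-1 <= D%:E.
  apply: le_trans uD; rewrite /Hdot_norm gagliardoE LnormE.
  by rewrite leeDr// poweR_ge0.
have : (int_pow q u `^ q^-1) `^ q <= D%:E `^ q.
  apply: gt0_ler_poweR => //; first exact: ltW.
    by rewrite in_itv/= poweR_ge0 leey.
  by rewrite in_itv/= lee_fin D0 leey.
by rewrite -poweRrM mulVf ?gt_eqF// poweRe1 ?int_pow_ge0// poweR_EFin.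
Qed.

Lemma dirichletZ (c : R) u : measurable_fun setT u ->
  dirichlet s (fun x => c * u x)%R = (c ^+ 2)%:E * dirichlet s u.
Proof.
move=> mu_; rewrite /dirichlet -ge0_integralZl_EFin ?sqr_ge0//; last 2 first.
- by move=> z _; rewrite lee_fin diffquot_ge0.
- by apply/measurable_EFinP; exact: measurable_diffquot.
apply: eq_integral => z _; rewrite -EFinM /diffquot; congr EFin.
by rewrite -mulrBr exprMn -mulrA.
Qed.

Lemma int_powZ (p c : R) u : (0 <= c)%R -> measurable_fun setT u ->
  int_pow p (fun x => c * u x)%R = (c `^ p)%:E * int_pow p u.
Proof.
move=> c0 mu_; rewrite /int_pow -ge0_integralZl_EFin ?powR_ge0//; last first.
  by apply/measurable_EFinP; exact: measurable_pow_norm.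
by apply: eq_integral => x _; rewrite -EFinM normrM (ger0_norm c0) powRM.
Qed.

Lemma int_powD_le (p : R) u v : (0 < p)%R ->
  measurable_fun setT u -> measurable_fun setT v ->
  int_pow p (u \+ v)%R <= (2 `^ p)%:E * (int_pow p u + int_pow p v).
Proof.
move=> p0 mu_ mv; rewrite /int_pow.
have me w : measurable_fun setT w -> measurable_fun setT (fun x => (`|w x| `^ p)%:E).
  by move=> ?; apply/measurable_EFinP; exact: measurable_pow_norm.
have e0 w x : 0 <= (`|w x| `^ p)%:E by rewrite lee_fin powR_ge0.
rewrite -ge0_integralD//; try exact: me.
rewrite -ge0_integralZl_EFin ?powR_ge0//; last 2 first.
- by move=> x _; rewrite adde_ge0.
- by apply: emeasurable_funD; exact: me.
apply: ge0_le_integral => //.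
- by apply: me; exact: measurable_funD.
- by apply: measurable_funeM; apply: emeasurable_funD; exact: me.
move=> x _; rewrite -EFinD -EFinM lee_fin.
have maxE : ((Num.max `|u x| `|v x|) `^ p <= `|u x| `^ p + `|v x| `^ p)%R.
  by case: (leP `|u x|%R `|v x|%R) => _; [rewrite lerDr powR_ge0|rewrite lerDl powR_ge0].
apply: le_trans (ler_wpM2l (powR_ge0 _ _) maxE).
rewrite -powRM// ?le_max ?normr_ge0// ler_powR2r ?mulr_ge0 ?le_max ?normr_ge0//.
apply: (le_trans (ler_normD _ _)); rewrite mulr_natl mulr2n.
by rewrite lerD// le_max lexx ?orbT.
Qed.

Lemma Hdot_normZ (c : R) u : (0 <= c)%R -> measurable_fun setT u ->
  Hdot_norm s (fun x => c * u x)%R = c%:E * Hdot_norm s u.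
Proof.
move=> c0 mu_; have q0 := critical_exponent_gt0 hs hN.
rewrite /Hdot_norm !gagliardoE !LnormE dirichletZ// int_powZ//.
rewrite !poweRM ?lee_fin ?sqr_ge0 ?powR_ge0 ?dirichlet_ge0 ?int_pow_ge0//.
rewrite !poweR_EFin -powRrM divff ?gt_eqF// powRr1// powR12_sqrt ?sqr_ge0//.
by rewrite sqrtr_sqr ger0_norm// -ge0_muleDr ?poweR_ge0.
Qed.

(** Inequalities between energies are proved for the integrands and integrated
    through this statement; two terms on each side are needed for the pair of
    perturbations in the study of differences. *)
Lemma le_dirichlet_comb u1 u2 u3 v1 v2 (c : R) : (0 <= c)%R ->
  measurable_fun setT u1 -> measurable_fun setT u2 -> measurable_fun setT u3 ->
  measurable_fun setT v1 -> measurable_fun setT v2 ->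
  (forall z, diffquot s u1 z + diffquot s u2 z + c * diffquot s u3 z <=
    diffquot s v1 z + diffquot s v2 z)%R ->
  dirichlet s u1 + dirichlet s u2 + c%:E * dirichlet s u3 <=
  dirichlet s v1 + dirichlet s v2.
Proof.
move=> c0 m1 m2 m3 m4 m5 H.
have md u : measurable_fun setT u -> measurable_fun setT (fun z => (diffquot s u z)%:E).
  by move=> ?; apply/measurable_EFinP; exact: measurable_diffquot.
have d0 u z : 0 <= (diffquot s u z)%:E by rewrite lee_fin diffquot_ge0.
rewrite /dirichlet -ge0_integralZl_EFin//; last exact: md.
rewrite -!ge0_integralD//; try exact: md.
- apply: ge0_le_integral => //.
  + by move=> z _; rewrite !adde_ge0// mule_ge0.
  + apply: emeasurable_funD; last by apply: measurable_funeM; exact: md.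
    by apply: emeasurable_funD; exact: md.
  + by apply: emeasurable_funD; exact: md.
  + by move=> z _; rewrite -EFinM -!EFinD lee_fin.
- by move=> z _; rewrite adde_ge0.
- by apply: emeasurable_funD; exact: md.
- by move=> z _; rewrite mule_ge0.
- by apply: measurable_funeM; exact: md.
Qed.

Lemma dirichletD_le u v : measurable_fun setT u -> measurable_fun setT v ->
  dirichlet s (u \+ v)%R <= 2%:E * (dirichlet s u + dirichlet s v).
Proof.
move=> mu_ mv; have d0 w z : 0 <= (diffquot s w z)%:E by rewrite lee_fin diffquot_ge0.
have md w : measurable_fun setT w -> measurable_fun setT (fun z => (diffquot s w z)%:E).
  by move=> ?; apply/measurable_EFinP; exact: measurable_diffquot.
rewrite /dirichlet -ge0_integralD//; try exact: md.
rewrite -ge0_integralZl_EFin//; last 2 first.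
- by move=> z _; rewrite adde_ge0.
- by apply: emeasurable_funD; exact: md.
apply: ge0_le_integral => //.
- by apply: md; exact: measurable_funD.
- by apply: measurable_funeM; apply: emeasurable_funD; exact: md.
move=> z _; rewrite -EFinD -EFinM lee_fin /diffquot -mulrDl mulrA.
rewrite ler_wpM2r ?kernel_ge0//=.
set x := u z.1; set y := u z.2; set x' := v z.1; set y' := v z.2.
have := sqr_ge0 (x - y - (x' - y'))%R.
rewrite -subr_ge0 => h; rewrite -subr_ge0; apply: le_trans h _; rewrite subr0.
rewrite le_eqVlt; apply/orP; left; apply/eqP; ring.
Qed.

End Hdot_facts.

Section shift_facts.
Context (R : realType) (N : nat).
Variable s : R.
Hypothesis (hs : 0 < s < 1) (hN : 2 * s < N%:R).
Local Notation V := 'rV[R]_N.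
Local Notation mu := (lebesgue_rV R N).
Local Notation q := (critical_exponent N s).
Implicit Types (u v w phi : V -> R) (z : V).

Definition shift z (u : V -> R) : V -> R := fun x => u (x + z).

Lemma measurable_shift z u : measurable_fun setT u -> measurable_fun setT (shift z u).
Proof. by move=> mu_; apply: (measurableT_comp mu_); exact: measurable_shift_rV. Qed.

Lemma ae_shift z (Q : V -> Prop) :
  (\forall x \ae mu, Q x) -> \forall x \ae mu, Q (x + z).
Proof.
move=> [A [mA A0 QA]]; exists ((fun x => x + z) @^-1` A); split.
- by rewrite -[X in measurable X]setTI; exact: measurable_shift_rV.
- by rewrite -A0; exact: lebesgue_rV_shift.
- by move=> x /= Qx; exact: QA.
Qed.

Lemma int_pow_shift p z u : measurable_fun setT u ->
  int_pow p (shift z u) = int_pow p u.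
Proof.
move=> mu_; rewrite /int_pow.
apply: (ge0_integral_shift z (f := fun x => (`|u x| `^ p)%:E)).
  by apply/measurable_EFinP; exact: measurable_pow_norm.
by move=> x; rewrite lee_fin powR_ge0.
Qed.

Lemma dirichlet_shift z u : measurable_fun setT u ->
  dirichlet s (shift z u) = dirichlet s u.
Proof.
move=> mu_; rewrite (dirichletE s mu_) (dirichletE s (measurable_shift z mu_)).
have shiftE x y : diffquot s (shift z u) (x, y) = diffquot s u (x + z, y + z).
  by rewrite /diffquot/= /shift opprD addrACA subrr addr0.
have innerE x : energy_density s (shift z u) x = energy_density s u (x + z).
  transitivity (\int[mu]_y (diffquot s u (x + z, y + z))%:E)%E.
    by apply: eq_integral => y _; rewrite shiftE.
  apply: (ge0_integral_shift z (f := fun y => (diffquot s u (x + z, y))%:E)).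
    apply/measurable_EFinP.
    by apply: (measurableT_comp (measurable_diffquot s mu_)); exact: measurable_pair1.
  by move=> y; rewrite lee_fin diffquot_ge0.
transitivity (\int[mu]_x energy_density s u (x + z))%E.
  by apply: eq_integral => x _; exact: innerE.
apply: (ge0_integral_shift z (f := energy_density s u)).
  exact: measurable_energy_density.
by move=> x; apply: integral_ge0 => y _; rewrite lee_fin diffquot_ge0.
Qed.

Lemma Hdot_shift z u : Hdot s u -> Hdot s (shift z u).
Proof.
move=> /(HdotP hs hN)[mu_ Du Lu]; apply/(HdotP hs hN); split.
- exact: measurable_shift.
- by rewrite dirichlet_shift.
- by rewrite int_pow_shift.
Qed.

Lemma HdotZ (c : R) u : Hdot s u -> Hdot s (fun x => c * u x).
Proof.
have q0 := critical_exponent_gt0 hs hN.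
move=> /(HdotP hs hN)[mu_ Du Lu]; have mcu : measurable_fun setT (fun x => c * u x).
  exact: measurable_funM.
apply/(HdotP hs hN); split; first exact: mcu.
  by rewrite dirichletZ// lte_mul_pinfty// lee_fin sqr_ge0.
have mcu' : measurable_fun setT (fun x => `|c| * u x) by exact: measurable_funM.
apply: (@le_lt_trans _ _ (int_pow q (fun x => `|c| * u x))).
  by apply: int_pow_le => //; [exact: ltW|move=> x; rewrite !normrM normr_id].
by rewrite int_powZ// lte_mul_pinfty// lee_fin powR_ge0.
Qed.

Lemma HdotD u v : Hdot s u -> Hdot s v -> Hdot s (u \+ v).
Proof.
move=> /(HdotP hs hN)[mu_ Du Lu] /(HdotP hs hN)[mv Dv Lv].
apply/(HdotP hs hN); split; first exact: measurable_funD.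
  by apply: le_lt_trans (dirichletD_le s mu_ mv) _; rewrite lte_mul_pinfty//; exact: lte_add_pinfty.
apply: le_lt_trans (int_powD_le (critical_exponent_gt0 hs hN) mu_ mv) _.
apply: lte_mul_pinfty; [by rewrite lee_fin powR_ge0|by []|].
exact: lte_add_pinfty Lu Lv.
Qed.

Lemma excess_monotone (k x y : R) (e := fun t => Num.max 0 (t - k)) :
  (e x - e y) ^+ 2 <= (x - y) * (e x - e y).
Proof.
rewrite /e -subr_ge0; case: (leP 0 (x - k)) => hx; case: (leP 0 (y - k)) => hy; nra.
Qed.

Lemma diffquot_excess_le k w (z : V * V) : diffquot s (excess k w) z <= diffquot s w z.
Proof.
rewrite /diffquot ler_wpM2r ?kernel_ge0// /excess.
have := excess_monotone k (w z.1) (w z.2) => /=.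
set X := Num.max _ _; set Y := Num.max _ _ => h.
have := sqr_ge0 (w z.1 - w z.2 - (X - Y)); nra.
Qed.

Lemma Hdot_excess k w : 0 <= k -> Hdot s w -> Hdot s (excess k w).
Proof.
have q0 := critical_exponent_gt0 hs hN.
move=> k0 /(HdotP hs hN)[mw Dw Lw]; apply/(HdotP hs hN); split.
- exact: measurable_excess.
- apply: le_lt_trans Dw; apply: ge0_le_integral => //.
  + by move=> z _; rewrite lee_fin diffquot_ge0.
  + by apply/measurable_EFinP; apply: measurable_diffquot; exact: measurable_excess.
  + by apply/measurable_EFinP; exact: measurable_diffquot.
  + by move=> z _; rewrite lee_fin diffquot_excess_le.
- apply: le_lt_trans Lw; apply: int_pow_le => //; [exact: ltW|exact: measurable_excess|].
  by move=> x; rewrite ger0_norm ?excess_ge0// excess_le.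
Qed.

End shift_facts.

(** * Continuity of translations in L^2 *)

Section shift_L2.
Context (R : realType) (N : nat).
Variable s : R.
Hypothesis (hs : 0 < s < 1) (hN : 2 * s < N%:R).
Local Notation V := 'rV[R]_N.
Local Notation mu := (lebesgue_rV R N).
Implicit Types (u : V -> R) (z : V).
Variable u : V -> R.
Hypothesis mu_ : measurable_fun setT u.

Let dsq (p : V * V) : R := (u (p.1 + p.2) - u p.1) ^+ 2.

Let mdsq : measurable_fun setT dsq.
Proof.
apply: measurable_funX; apply: measurable_funB.
  apply: (measurableT_comp mu_); exact: measurable_add_rV.
exact: (measurableT_comp mu_).
Qed.

Definition shift_sq z : \bar R := (\int[mu]_x ((u (x + z)%R - u x) ^+ 2)%:E)%E.

Lemma measurable_shift_sq : measurable_fun setT shift_sq.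
Proof.
apply: (@measurable_fun_fubini_tonelli_G _ _ _ _ _ mu (EFin \o dsq)).
  exact/measurable_EFinP.
by move=> p; rewrite lee_fin sqr_ge0.
Qed.

Lemma shift_sq_ge0 z : (0 <= shift_sq z)%E.
Proof. by apply: integral_ge0 => x _; rewrite lee_fin sqr_ge0. Qed.

Let mdsq2 z : measurable_fun setT (fun x : V => ((u (x + z) - u x) ^+ 2)%:E).
Proof.
apply/measurable_EFinP.
exact: (measurableT_comp mdsq (measurable_pair2 z)).
Qed.

(** Substituting y = x + z and exchanging the integrals turns the energy into an
    average over z of the squared L^2 distance between u and its translate. *)
Lemma dirichlet_shiftE :
  dirichlet s u = (\int[mu]_y ((kernel s y)%:E * shift_sq y))%E.
Proof.
rewrite (dirichletE s mu_).
pose H (p : V * V) : \bar R := (kernel s p.2 * dsq p)%:E.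
have mH : measurable_fun setT H.
  apply/measurable_EFinP; apply: measurable_funM => //.
  by apply: (measurableT_comp (measurable_kernel s)).
have H0 p : (0 <= H p)%E by rewrite lee_fin mulr_ge0 ?kernel_ge0 ?sqr_ge0.
transitivity (\int[mu]_x \int[mu]_y H (x, y))%E.
  apply: eq_integral => x _.
  rewrite -(ge0_integral_shift x (f := fun y => (diffquot s u (x, y))%:E)); last 2 first.
  - apply/measurable_EFinP.
    by apply: (measurableT_comp (measurable_diffquot s mu_)); exact: measurable_pair1.
  - by move=> y; rewrite lee_fin diffquot_ge0.
  apply: eq_integral => y _; rewrite /H /diffquot /dsq /=; congr EFin.
  by rewrite opprD addrCA subrr addr0 kernelN mulrC (addrC y) -[in LHS]sqrrN opprB.
rewrite (fubini_tonelli H)//; apply: eq_integral => y _.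
rewrite /shift_sq -ge0_integralZl_EFin ?kernel_ge0//.
by move=> x _; rewrite lee_fin sqr_ge0.
Qed.

(** From u(x+z) - u(x) = (u(x+y+z) - u(x)) - (u(x+z+y) - u(x+z)), where the last
    difference is a translate of u(x+y) - u(x). *)
Lemma shift_sq_triangle z y : (shift_sq z <= 2%:E * (shift_sq y + shift_sq (y + z)%R))%E.
Proof.
have -> : shift_sq y = (\int[mu]_x ((u ((x + z) + y)%R - u (x + z)%R) ^+ 2)%:E)%E.
  apply/esym; apply: (ge0_integral_shift z (f := fun x => ((u (x + y) - u x) ^+ 2)%:E)) => //.
  by move=> x; rewrite lee_fin sqr_ge0.
have m1 : measurable_fun setT (fun x : V => ((u ((x + z) + y) - u (x + z)) ^+ 2)%:E).
  by apply: (measurableT_comp (mdsq2 y)); exact: measurable_shift_rV.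
rewrite /shift_sq -ge0_integralD//; last 2 first.
- by move=> x _; rewrite lee_fin sqr_ge0.
- by move=> x _; rewrite lee_fin sqr_ge0.
rewrite -ge0_integralZl_EFin//; last 2 first.
- by move=> x _; rewrite adde_ge0// lee_fin sqr_ge0.
- exact: emeasurable_funD.
apply: ge0_le_integral => //.
- by move=> x _; rewrite lee_fin sqr_ge0.
- by apply: measurable_funeM; exact: emeasurable_funD.
move=> x _; rewrite -EFinD -EFinM lee_fin.
rewrite (_ : x + (y + z) = x + z + y); last by rewrite (addrC y) addrA.
set p := u (x + z + y); set b := u (x + z); set c := u x.
have := sqr_ge0 ((p - b) + (p - c)); nra.
Qed.

Lemma cube_add (z y : V) r : cube 0 r z -> cube 0 r y -> cube 0 (2 * r) (y + z).
Proof.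
move=> hz hy i; have := hz i; have := hy i; rewrite !mxE !subr0 => h1 h2.
by apply: (le_lt_trans (ler_normD _ _)); lra.
Qed.

(** The triangle inequality is averaged over y in the cube of half-side r: both y
    and y + z stay in the cube of half-side 2r, where the kernel is at least
    [kernel_floor]. *)
Lemma shift_sq_le r z : 0 < r -> cube 0 r z ->
  (((2 * r) ^+ N * kernel_floor N s (2 * r))%:E * shift_sq z <= 4%:E * dirichlet s u)%E.
Proof.
move=> r0 rz; have r20 : 0 < 2 * r by rewrite mulr_gt0.
have fl0 := kernel_floor_gt0 hs hN r20.
pose hc := shift_sq \_ (cube 0 (2 * r)).
have mhc : measurable_fun setT hc.
  have /(measurable_restrictT _ (measurable_cube 0 (2 * r))) :
    measurable_fun (cube 0 (2 * r)) shift_sq.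
    by apply: measurable_funTS; exact: measurable_shift_sq.
  exact.
have hc0 y : (0 <= hc y)%E.
  by rewrite /hc patchE; case: ifP => // _; exact: shift_sq_ge0.
have step1 : ((kernel_floor N s (2 * r))%:E * \int[mu]_y hc y <= dirichlet s u)%E.
  rewrite dirichlet_shiftE -ge0_integralZl_EFin ?(ltW fl0)//.
  apply: ge0_le_integral => //.
  - by move=> y _; rewrite mule_ge0// lee_fin ltW.
  - exact: measurable_funeM.
  - apply: emeasurable_funM; last exact: measurable_shift_sq.
    by apply/measurable_EFinP; exact: measurable_kernel.
  move=> y _; rewrite /hc patchE; case: ifPn => [|_]; last first.
    by rewrite mule0 mule_ge0 ?shift_sq_ge0// lee_fin kernel_ge0.
  rewrite inE => hy; have [->|y0] := eqVneq y 0.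
    have -> : shift_sq 0 = 0%E.
      by rewrite /shift_sq; apply: integral0_eq => x _; rewrite addr0 subrr expr0n.
    by rewrite !mule0.
  rewrite lee_wpmul2r ?shift_sq_ge0// lee_fin -kernelN -[- y]add0r.
  by apply: le_kernel_floor; rewrite 1?eq_sym ?(ltW r20).
have step2 : (((2 * r) ^+ N)%:E * shift_sq z <= 4%:E * \int[mu]_y hc y)%E.
  rewrite -(lebesgue_rV_cube 0 (ltW r0)) muleC.
  have mhz : measurable_fun setT (fun y : V => hc (y + z)).
    by apply: (measurableT_comp mhc); exact: measurable_shift_rV.
  apply: (@le_trans _ _ (\int[mu]_y (2%:E * (hc y + hc (y + z)%R)))%E).
    apply: le_integral_set.
    - exact: measurable_cube.
    - by apply: measurable_funeM; exact: emeasurable_funD.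
    - by move=> y; rewrite mule_ge0// adde_ge0.
    - exact: shift_sq_ge0.
    move=> y ry; apply: (le_trans (shift_sq_triangle z y)).
    rewrite lee_pmul2l// /hc !patchE !mem_set//; first exact: cube_add.
    by move=> i; apply: lt_trans (ry i) _; lra.
  rewrite ge0_integralZl_EFin//; last 2 first.
  - by move=> y _; rewrite adde_ge0.
  - exact: emeasurable_funD.
  rewrite ge0_integralD// (ge0_integral_shift z (f := hc))//.
  have I0 : (0 <= \int[mu]_y hc y)%E by apply: integral_ge0.
  have -> : 4%:E = (2%:E + 2%:E)%E :> \bar R by rewrite -EFinD; congr EFin; ring.
  by rewrite ge0_muleDl// ge0_muleDr.
have [D0 S0] := (dirichlet_ge0 s u, shift_sq_ge0 z).
rewrite mulrC EFinM -muleA.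
apply: (@le_trans _ _ ((kernel_floor N s (2 * r))%:E * (4%:E * \int[mu]_y hc y))%E).
  by rewrite lee_pmul2l.
by rewrite muleCA lee_pmul2l.
Qed.

(** The factor in front of the squared distance is a constant times r^(-2s). *)
Lemma shift_L2_continuous : (dirichlet s u < +oo)%E -> forall eta : R, 0 < eta ->
  exists2 r, 0 < r & forall z, cube 0 r z -> (shift_sq z <= eta%:E)%E.
Proof.
move=> Du eta eta0; have N0 := N_gt0 hs hN; have s0 : 0 < s by case/andP: hs.
have [d d0 dE] := dirichlet_fin Du.
pose c := Num.sqrt N%:R `^ (N%:R + 2 * s) : R.
have c0 : 0 < c by rewrite powR_gt0// sqrtr_gt0.
pose b := eta / (4 * c * (d + 1)).
have b0 : 0 < b by rewrite divr_gt0// !mulr_gt0// ltr_wpDl.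
pose t := b `^ (2 * s)^-1; have t0 : 0 < t by rewrite powR_gt0.
exists (t / 2) => [|z tz]; first by rewrite divr_gt0.
have t20 : 0 < t / 2 by rewrite divr_gt0.
have := shift_sq_le t20 tz; rewrite dE mulrCA divff// mulr1.
have -> : t ^+ N * kernel_floor N s t = (c * b)^-1.
  rewrite /kernel_floor powRM ?sqrtr_ge0 ?(ltW t0)// -/c powRD; last first.
    by rewrite (gt_eqF t0) implybT.
  rewrite powR_mulrn ?(ltW t0)// [t `^ (2 * s)](_ : _ = b); last first.
    by rewrite /t -powRrM mulVf ?powRr1 ?(ltW b0)// gt_eqF// mulr_gt0.
  by field; rewrite !gt_eqF// exprn_gt0.
have cb0 : 0 < (c * b)^-1 by rewrite invr_gt0 mulr_gt0.
rewrite -lee_pdivlMl// invrK => /le_trans; apply.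
rewrite -!EFinM lee_fin /b.
rewrite [leLHS](_ : _ = eta * (d / (d + 1))); last first.
  by field; rewrite !gt_eqF// ltr_wpDl.
by rewrite ler_piMr ?(ltW eta0)// ler_pdivrMr ?mul1r ?lerDl// ltr_wpDl.
Qed.

End shift_L2.

(** * Continuous representatives *)

Lemma ge0_integral_eq0P d (T : measurableType d) (R : realType)
    (nu : {measure set T -> \bar R}) (h : T -> \bar R) :
  measurable_fun setT h -> (forall x, 0 <= h x)%E ->
  (\int[nu]_x h x = 0)%E <-> \forall x \ae nu, h x = 0%E.
Proof.
move=> mh h0; have := ae_eq_integral_abs nu measurableT mh => H.
have -> : (\int[nu]_x h x = \int[nu]_x `|h x|)%E.
  by apply: eq_integral => x _; rewrite gee0_abs.
split=> [/H|hae]; first by apply: filterS => x; exact.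
by apply/H; apply: filterS hae => x hx _.
Qed.

Section continuous_representative.
Context (R : realType) (N : nat).
Local Notation V := 'rV[R]_N.
Local Notation mu := (lebesgue_rV R N).
Implicit Types (u : V -> R) (z : V).

(** Tonelli in the coordinates (x, y - x): a set that is null along almost all
    points of every translated diagonal is null. *)
Lemma ae_sections (B : set (V * V)) : measurable B ->
  (forall z, \forall x \ae mu, ~ B (x, z + x)) ->
  \forall x \ae mu, \forall y \ae mu, ~ B (x, y).
Proof.
move=> mB Bz.
pose h (p : V * V) : \bar R := (\1_B p)%:E.
have mh : measurable_fun setT h by apply/measurable_EFinP; exact: measurable_indic.
have h0 p : (0 <= h p)%E by rewrite lee_fin.
pose h' (p : V * V) := h (p.1, p.2 + p.1).
have mh' : measurable_fun setT h'.
  apply: (measurableT_comp mh); apply: measurable_fun_pair => //.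
  rewrite (_ : (fun _ => _) = (fun p : V * V => p.1 + p.2)); last first.
    by apply/funext => p; rewrite addrC.
  exact: measurable_add_rV.
have mhx x : measurable_fun setT (fun y => h (x, y)).
  by apply: (measurableT_comp mh); exact: measurable_pair1.
have I0 : (\int[mu]_x \int[mu]_y h (x, y) = 0)%E.
  transitivity (\int[mu]_x \int[mu]_z h' (x, z))%E.
    apply: eq_integral => x _.
    exact: (esym (ge0_integral_shift x (f := fun y => h (x, y)) _ _)).
  rewrite (fubini_tonelli h')//; last by move=> p; exact: h0.
  apply: integral0_eq => z _; apply/ge0_integral_eq0P => //.
  - by apply: (measurableT_comp mh'); exact: measurable_pair2.
  - by move=> x; exact: h0.
  - by apply: filterS (Bz z) => x nB; rewrite /h' /h/= indicE memNset.
have /ge0_integral_eq0P : (\int[mu]_x \int[mu]_y h (x, y) = 0)%E by [].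
move=> H; have {}H : \forall x \ae mu, (\int[mu]_y h (x, y) = 0)%E.
  apply: H; first exact: (measurable_fun_fubini_tonelli_F h).
  by move=> x; exact: integral_ge0.
apply: filterS H => x /ge0_integral_eq0P H.
apply: filterS (H (mhx x) (fun y => h0 (x, y))) => y.
rewrite /h indicE; case: (boolP ((x, y) \in B)) => [_ [] /eqP|]; first by rewrite oner_eq0.
by rewrite notin_setE.
Qed.

Lemma ae_meets_cube (m : V) (r : R) (Q : V -> Prop) : 0 < r ->
  (\forall y \ae mu, Q y) -> exists2 y, cube m r y & Q y.
Proof.
move=> r0 [A [mA A0 QA]]; apply: contrapT => H.
have : (mu (cube m r) <= mu A)%E.
  apply: le_measure; rewrite ?inE//; first exact: measurable_cube.
  move=> y my; apply: QA => Qy; apply: H; by exists y.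
rewrite A0 lebesgue_rV_cube ?(ltW r0)// lee_fin leNgt.
by rewrite exprn_gt0// mulr_gt0.
Qed.

Lemma nbhs_cube (x : V) (r : R) : 0 < r -> nbhs x (cube x r).
Proof.
move=> r0; apply: filterS (nbhsx_ballx x r r0) => y [_ xy] i.
by have := xy 0 i; rewrite /ball/= distrC.
Qed.

Lemma cube_midpoint (x y m : V) r : cube x r y -> cube (2^-1 *: (x + y)) (r / 2) m ->
  cube x r m /\ cube y r m.
Proof.
move=> xy hm; split=> i; have := hm i; have := xy i; rewrite !mxE !ltr_norml;
by move=> /andP[? ?] /andP[? ?]; apply/andP; split; lra.
Qed.

(** By Tonelli, for almost every x the estimate |u(x) - u(y)| <= eps_n holds for
    almost every y near x, simultaneously for all n. Two such points x, x' that
    are close to each other have a common good neighbour y, so that u is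
    uniformly continuous on a set of full measure, from which it extends. *)
Lemma continuous_representative u : measurable_fun setT u ->
  (forall e, 0 < e -> exists2 r, 0 < r &
    forall z, cube 0 r z -> \forall x \ae mu, u (x + z) - u x <= e) ->
  has_continuous_representative u.
Proof.
move=> mu_ Hu.
have [eps [eps0 small]] : exists eps : nat -> R, (forall n, 0 < eps n) /\
    forall e, 0 < e -> exists n, 4 * eps n < e.
  exists (fun n => n.+1%:R^-1); split => [n|e e0]; first by rewrite invr_gt0.
  have e40 : 0 < e / 4 by rewrite divr_gt0.
  have [n _ /(_ n (leqnn n)) /= h] := near_infty_natSinv_lt (PosNum e40).
  by exists n; move: h; rewrite /= ltr_pdivlMr// mulrC.
have /choice[r Hr] : forall n, exists r : R, 0 < r /\ forall z, cube 0 r z ->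
    \forall x \ae mu, u (x + z) - u x <= eps n.
  by move=> n; have [r r0 H] := Hu _ (eps0 n); exists r.
have r0 n : 0 < r n by case: (Hr n).
(* the pairs at distance less than r_n where the oscillation exceeds eps_n *)
pose B n : set (V * V) := [set p | cube 0 (r n) (p.1 - p.2)] `&`
  [set p | eps n < `|u p.1 - u p.2|].
have mB n : measurable (B n).
  apply: measurableI.
    have := @measurable_sub_rV R N => /(_ measurableT _ (measurable_cube 0 (r n))).
    by rewrite setTI.
  have : measurable_fun setT (fun p : V * V => `|u p.1 - u p.2|).
    apply: measurableT_comp => //; apply: measurable_funB.
      exact: (measurableT_comp mu_).
    exact: (measurableT_comp mu_).
  move=> /(_ measurableT `]eps n, +oo[%classic (measurable_itv _)).
  by rewrite setTI preimage_itvoy.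
have Bz n z : \forall x \ae mu, ~ B n (x, z + x).
  have [hz|nhz] := pselect (cube 0 (r n) (- z)); last first.
    apply: aeW => x [/= + _]; rewrite opprD addrCA subrr addr0; exact: nhz.
  have hz' : cube 0 (r n) z.
    by move=> i; have := hz i; rewrite !mxE !subr0 normrN.
  have h1 := (Hr n).2 _ hz'; have h2 := ae_shift z ((Hr n).2 _ hz).
  apply: filterS2 h1 h2 => x; rewrite addrK => h1 h2 [_ /=].
  rewrite ltNge => /negP; apply; rewrite (addrC z) distrC ler_norml h1 andbT.
  by rewrite lerNl opprB.
pose D : set V := [set x | forall n, \forall y \ae mu, ~ B n (x, y)].
have aeD : \forall x \ae mu, D x.
  by apply: ae_foralln => n; apply: ae_sections => //; exact: Bz.
have uD n x y : D x -> D y -> cube x (r n) y -> `|u x - u y| <= 2 * eps n.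
  move=> Dx Dy xy.
  have r20 : 0 < r n / 2 by rewrite divr_gt0.
  have near_xy : \forall m \ae mu, ~ B n (x, m) /\ ~ B n (y, m).
    by apply: filterS2 (Dx n) (Dy n).
  have [m hm [Bx By]] := ae_meets_cube (2^-1 *: (x + y)) r20 near_xy.
  have [xm ym] := cube_midpoint xy hm.
  have close p : cube p (r n) m -> ~ B n (p, m) -> `|u p - u m| <= eps n.
    move=> pm nB; rewrite leNgt; apply/negP => lt; apply: nB; split => //= i.
    by rewrite !mxE subr0 distrC.
  have := close _ xm Bx; have := close _ ym By => h1 h2.
  rewrite (_ : u x - u y = (u x - u m) - (u y - u m)); last by ring.
  by apply: (le_trans (ler_normB _ _)); lra.
have r20 n : 0 < r n / 2 by rewrite divr_gt0.
have sub_half (x y y' : V) n : cube x (r n / 2) y -> cube x (r n / 2) y' -> cube y (r n) y'.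
  move=> h1 h2 i; have := h1 i; have := h2 i; rewrite !ltr_norml.
  by move=> /andP[? ?] /andP[? ?]; apply/andP; split; lra.
(* The extension is the supremum of the lower bounds u(y) - 2 eps_n that the good
   points y near x impose on its value at x. *)
pose S x := [set t | exists n y, [/\ cube x (r n / 2) y, D y & t = u y - 2 * eps n]].
have S_le x n y : cube x (r n / 2) y -> D y -> ubound (S x) (u y + 2 * eps n).
  move=> xy Dy _ [n' [y' [xy' Dy' ->]]].
  have en := eps0 n; have en' := eps0 n'.
  (* both points lie in the larger of the two cubes, whose estimate applies *)
  have [rn|/ltW rn] := leP (r n) (r n').
    have xy2 : cube x (r n' / 2) y by move=> i; apply: lt_le_trans (xy i) _; lra.
    have := uD _ _ _ Dy Dy' (sub_half _ _ _ _ xy2 xy').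
    by rewrite ler_norml => /andP[? ?]; lra.
  have xy2 : cube x (r n / 2) y' by move=> i; apply: lt_le_trans (xy' i) _; lra.
  have := uD _ _ _ Dy Dy' (sub_half _ _ _ _ xy xy2).
  by rewrite ler_norml => /andP[? ?]; lra.
pose v x := sup (S x).
have vu x n y : cube x (r n / 2) y -> D y -> `|v x - u y| <= 2 * eps n.
  move=> xy Dy; have Sy : S x (u y - 2 * eps n) by exists n, y.
  have h1 : v x <= u y + 2 * eps n.
    by apply: ge_sup; [exists (u y - 2 * eps n)|exact: S_le].
  have h2 : u y - 2 * eps n <= v x.
    by apply: ub_le_sup => //; exists (u y + 2 * eps n); exact: S_le.
  by rewrite ler_norml; apply/andP; split; lra.
exists v.
  move=> x; apply/(@cvgrPdist_lt R R^o V (nbhs x) (nbhs_filter x)) => e /small [n ne].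
  apply: filterS (nbhs_cube x (r20 n)) => x' xx'.
  have r40 : 0 < (r n / 2) / 2 by rewrite divr_gt0.
  have [y hm Dy] := ae_meets_cube (2^-1 *: (x + x')) r40 aeD.
  have [xy x'y] := cube_midpoint xx' hm.
  have h1 := vu _ _ _ xy Dy; have h2 := vu _ _ _ x'y Dy.
  rewrite (_ : v x - v x' = (v x - u y) - (v x' - u y)); last by ring.
  apply: le_lt_trans (ler_normB _ _) _; lra.
apply: filterS aeD => x Dx _ /=.
apply/eqP; rewrite -subr_eq0 -normr_le0; apply/ler_addgt0Pr => e /small [n ne]; rewrite add0r.
have xx : cube x (r n / 2) x by move=> i; rewrite subrr normr0.
by have := vu _ _ _ xx Dx; rewrite distrC; have := eps0 n; lra.
Qed.

End continuous_representative.

(** * Growth of the nonlinearity and of its primitive *)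

Lemma lebesgue_measure_segment_lty (R : realType) (x y : R) :
  (@lebesgue_measure R `[x, y]%classic < +oo)%E.
Proof.
by rewrite lebesgue_measure_itv/=; case: ifP => // _; rewrite -EFinB ltry.
Qed.

Section nonlinearity.
Context (R : realType).
Variable f : R -> R.
Hypothesis (cf : {within `[0, +oo[, continuous f}).

(** The limit of f(t) / t^(gam - 1) controls f near infinity, compactness
    controls it elsewhere. *)
Lemma subcritical_growth (q : R) : condition_f1 f q ->
  exists gam C : R, [/\ 2 < gam < q, 0 < C &
    forall t, 0 <= t -> `|f t| <= C * (1 + t `^ (gam - 1))].
Proof.
case=> _ _ [gam [_ [l [gq _ fl _]]]].
have /cvgrPdist_lt/(_ 1 ltr01) [T [_ HT]] := fl.
pose T' := Num.max T 1.
have T'0 : 0 <= T' by rewrite le_max ler01 orbT.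
have cT : {within `[0, T'], continuous f}.
  apply: continuous_subspaceW cf; apply: subset_itvl; by rewrite bnd_simp.
have [c1 _ max1] := EVT_max T'0 cT.
have [c2 _ min1] := EVT_min T'0 cT.
pose C := `|l| + 1 + `|f c1| + `|f c2|.
exists gam, C; split => // [|t t0].
  by rewrite /C -!addrA ltr_wpDl// ltr_wpDr// addr_ge0.
have C0 : 0 <= C by rewrite !addr_ge0.
have [tT|Tt] := leP t T'.
  have tI : t \in `[0, T'] by rewrite in_itv/= t0.
  have := max1 _ tI; have := min1 _ tI => h1 h2.
  apply: (@le_trans _ _ (C * 1)); last by rewrite ler_wpM2l// lerDl powR_ge0.
  rewrite mulr1 ler_norml; apply/andP; split.
    apply: le_trans h1; rewrite lerNl /C.
    have := ler_norm (- f c2); rewrite normrN.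
    have := normr_ge0 l; have := normr_ge0 (f c1); lra.
  apply: (le_trans h2); rewrite /C.
  have := ler_norm (f c1).
  have := normr_ge0 l; have := normr_ge0 (f c2); lra.
have t1 : 1 < t by apply: le_lt_trans Tt; rewrite le_max lexx orbT.
have Tt' : T < t by apply: le_lt_trans Tt; rewrite le_max lexx.
have tg0 : 0 < t `^ (gam - 1) by rewrite powR_gt0// (lt_trans _ t1).
have := HT t Tt'; rewrite /= => h.
have h3 : `|f t / t `^ (gam - 1)| <= `|l| + 1.
  rewrite -[f t / _](subrK l); apply: le_trans (ler_normD _ _) _.
  by rewrite distrC addrC lerD2l ltW.
rewrite normrM normfV (gtr0_norm tg0) ler_pdivrMr// in h3.
apply: (le_trans h3); apply: ler_pM; [by rewrite addr_ge0|exact: powR_ge0| |].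
- by rewrite /C -addrA lerDl addr_ge0.
- by rewrite lerDr.
Qed.

Variables (a gam C : R).
Hypothesis (gam2 : 2 < gam) (C0 : 0 < C) (a0 : 0 <= a).
Hypothesis (fC : forall t, 0 <= t -> `|f t| <= C * (1 + t `^ (gam - 1))).

Local Notation h := (shifted f a).
Local Notation F := (shifted_primitive f a).
Local Notation M := (C + a).

Lemma measurable_shifted : measurable_fun setT h.
Proof.
rewrite -(setUv `[0, +oo[%classic) setCitvr; apply/measurable_funU => //; split.
  apply: (@eq_measurable_fun _ _ _ _ _ (fun t => f t - a)).
    by move=> t; rewrite inE/= in_itv/= andbT /shifted => ->.
  apply: measurable_funB => //.
  exact: subspace_continuous_measurable_fun.
apply: (@eq_measurable_fun _ _ _ _ _ (fun t => - a)) => //.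
by move=> t; rewrite inE/= in_itv/= /shifted => t0; rewrite leNgt t0.
Qed.

Lemma shifted_growth t : `|h t| <= M * (1 + `|t| `^ (gam - 1)).
Proof.
have p0 : 0 <= `|t| `^ (gam - 1) by exact: powR_ge0.
rewrite /shifted; case: ifPn => t0.
  apply: le_trans (ler_normB _ _) _; rewrite (ger0_norm a0) mulrDl lerD//.
    by rewrite (ger0_norm t0) fC.
  by rewrite ler_peMr// lerDl.
rewrite normrN ger0_norm// mulrDl.
have : a <= a * (1 + `|t| `^ (gam - 1)) by rewrite ler_peMr// lerDl.
move=> /le_trans; apply; rewrite lerDr mulr_ge0 ?ltW// addr_ge0.
Qed.

Lemma shifted_growth_segment x y t : x <= t <= y ->
  `|h t| <= M * (1 + `|x| `^ (gam - 1) + `|y| `^ (gam - 1)).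
Proof.
move=> /andP[xt ty]; apply: (le_trans (shifted_growth t)).
rewrite ler_wpM2l ?addr_ge0 ?(ltW C0)// -addrA lerD2l.
have gam1 : 0 < gam - 1 by move: gam2; lra.
have [t0|t0] := leP 0 t.
  apply: ler_wpDl; first exact: powR_ge0.
  by rewrite ler_powR2r// !ger0_norm// (le_trans t0).
apply: ler_wpDr; first exact: powR_ge0.
rewrite ler_powR2r// !ltr0_norm ?lerN2//; exact: le_lt_trans t0.
Qed.

Lemma integrable_shifted x y : lebesgue_measure.-integrable `[x, y] (EFin \o h).
Proof.
apply: measurable_bounded_integrable => //.
- exact: lebesgue_measure_segment_lty.
- exact: measurable_funTS measurable_shifted.
exists (M * (1 + `|x| `^ (gam - 1) + `|y| `^ (gam - 1))); split => //.
  exact: num_real.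
move=> b bM t /=; rewrite in_itv/= => xty.
by rewrite (le_trans (shifted_growth_segment xty))// ltW.
Qed.

Lemma le_integral_shifted x y b : x <= y ->
  (forall t, x <= t <= y -> `|h t| <= b) ->
  `|\int[lebesgue_measure]_(t in `[x, y]) h t| <= b * (y - x).
Proof.
move=> xy hb; apply: le_trans (le_normr_Rintegral _ (integrable_shifted _ _)) _ => //.
have := @Rintegral_cst _ _ _ (@lebesgue_measure R) `[x, y]%classic (measurable_itv _) b.
have -> : fine (lebesgue_measure `[x, y]%classic) = y - x.
  rewrite lebesgue_measure_itv/= lte_fin; move: xy; rewrite le_eqVlt => /predU1P[->|->//].
  by rewrite ltxx/= subrr.
move=> <-; apply: le_Rintegral => //.
- exact/integrable_norm/integrable_shifted.
- apply: measurable_bounded_integrable => //.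
    exact: lebesgue_measure_segment_lty.
  exists `|b|; split; first exact: num_real.
  by move=> B bB t _; rewrite ltW.
Qed.

Lemma shifted_primitiveB x y : x <= y ->
  F y - F x = \int[lebesgue_measure]_(t in `[x, y]) h t.
Proof.
move=> xy; rewrite /shifted_primitive.
have split_at u v w : u <= v -> v <= w ->
  \int[lebesgue_measure]_(t in `[u, w]) h t -
  \int[lebesgue_measure]_(t in `[u, v]) h t =
  \int[lebesgue_measure]_(t in `[v, w]) h t.
  move=> uv vw; rewrite Rintegral_itvB ?bnd_simp//; last exact: integrable_shifted.
  apply: Rintegral_itv_obnd_cbnd.
  apply: integrableS (integrable_shifted v w) => //.
  by apply: subset_itvr; rewrite bnd_simp.
have [x0|x0] := leP 0 x.
  by rewrite (le_trans x0 xy) split_at.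
have [y0|y0] := leP 0 y.
  by rewrite opprK -(split_at x 0 y (ltW x0) y0) subrK.
by rewrite opprK -(split_at x y 0 xy (ltW y0)); ring.
Qed.

(** The mean value theorem in integrated form, with the derivative bounded by its
    growth at both ends of the segment. *)
Lemma shifted_primitive_lipschitz x y :
  `|F y - F x| <= `|y - x| * (M * (1 + `|x| `^ (gam - 1) + `|y| `^ (gam - 1))).
Proof.
wlog xy : x y / x <= y => [H|].
  have [|/ltW] := leP x y; first exact: H.
  by move=> /H; rewrite distrC (distrC x) addrAC.
rewrite shifted_primitiveB// mulrC (@ger0_norm _ (y - x)) ?subr_ge0//.
apply: le_integral_shifted => // t; exact: shifted_growth_segment.
Qed.

Lemma shifted_primitive0 : F 0 = 0.
Proof. by rewrite /shifted_primitive lexx set_itv1 Rintegral_set1. Qed.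

Lemma measurable_shifted_primitive : measurable_fun setT F.
Proof.
apply: continuous_measurable_fun => x.
pose L := M * (1 + `|x| `^ (gam - 1) + (`|x| + 1) `^ (gam - 1)).
have L0 : 0 < L.
  by rewrite mulr_gt0 ?ltr_wpDr.
apply/cvgrPdist_lt => e e0; near=> y.
have yx1 : `|y - x| < 1.
  rewrite distrC; near: y; exact: (@nbhsx_ballx R R^o x 1 ltr01).
have yxe : `|y - x| < e / L.
  rewrite distrC; near: y; exact: (@nbhsx_ballx R R^o x _ (divr_gt0 e0 L0)).
rewrite distrC; apply: le_lt_trans (shifted_primitive_lipschitz x y) _.
apply: (@le_lt_trans _ _ (`|y - x| * L)); last by rewrite -ltr_pdivlMr.
rewrite ler_wpM2l// /L ler_wpM2l ?addr_ge0 ?(ltW C0)// lerD2l.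
have gam1 : 0 < gam - 1 by move: gam2; lra.
rewrite ler_powR2r// ?addr_ge0// -lerBlDl.
by apply: le_trans (lerB_dist _ _) (ltW yx1).
Unshelve. all: by end_near. Qed.

Lemma shifted_primitive_growth (q : R) t : gam <= q ->
  `|F t| <= 2 * M * (1 + `|t| `^ q).
Proof.
move=> gq; have M0 : 0 <= M by rewrite addr_ge0 ?(ltW C0).
have := shifted_primitive_lipschitz 0 t.
rewrite shifted_primitive0 !subr0 normr0 powR0 ?addr0; last by move: gam2 => ?; apply/eqP; lra.
move=> /le_trans; apply; rewrite mulrCA (mulrC 2) -mulrA ler_wpM2l//.
have := gam2 => gam2R.
rewrite mulrDr mulr1 mulr_powRB1//; last lra.
have tq0 := powR_ge0 `|t| q.
have [t1|t1] := leP `|t| 1.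
  have : `|t| `^ gam <= 1.
    have <- : 1 `^ gam = 1 :> R by rewrite powR1.
    by rewrite ler_powR2r//; lra.
  lra.
have := @ler_powR _ _ (ltW t1) _ _ gq.
have : `|t| <= `|t| `^ q by rewrite le1r_powR ?(ltW t1)//; lra.
lra.
Qed.

End nonlinearity.

(** * Quasi-minimality and Caccioppoli inequalities *)

Section rV_measure_facts.
Context (R : realType) (N : nat).
Local Notation mu := (lebesgue_rV R N).

Lemma lebesgue_rV_gt0 : (0 < mu [set: 'rV[R]_N])%E.
Proof.
have : (0 < mu (cube 0 1))%E by rewrite lebesgue_rV_cube// lte_fin exprn_gt0// mulr1.
move=> /lt_le_trans; apply; apply: le_measure; rewrite ?inE//.
exact: measurable_cube.
Qed.

Lemma Lfun_oo_bounded (g : 'rV[R]_N -> R) : g \in Lfun mu +oo ->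
  exists2 G : R, 0 < G & \forall x \ae mu, `|g x| <= G.
Proof.
rewrite inE => /andP[_]; rewrite inE /= /finite_norm unlock /= lebesgue_rV_gt0.
move=> /ess_supr_bounded[G gG]; exists (Num.max G 1).
  by rewrite lt_max ltr01 orbT.
by apply: filterS gG => x gx; rewrite le_max gx.
Qed.

Lemma Lfun1_integrable (g : 'rV[R]_N -> R) : g \in Lfun mu 1 ->
  measurable_fun setT g /\ (\int[mu]_x (`|g x|)%:E < +oo)%E.
Proof.
rewrite inE => /andP[]; rewrite !inE /= /finite_norm => mg.
by rewrite Lnorm1.
Qed.

End rV_measure_facts.

Section energy_estimates.
Context (R : realType) (N : nat).
Variable s : R.
Hypothesis (hs : 0 < s < 1) (hN : 2 * s < N%:R).
Local Notation V := 'rV[R]_N.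
Local Notation mu := (lebesgue_rV R N).
Local Notation q := (critical_exponent N s).
Implicit Types (u v w phi psi P : V -> R).
Variable f : R -> R.
Hypothesis (cf : {within `[0, +oo[, continuous f}).
Variables (a gam C : R).
Hypothesis (gam2 : 2 < gam < q) (C0 : 0 < C) (a0 : 0 <= a).
Hypothesis (fC : forall t, 0 <= t -> `|f t| <= C * (1 + t `^ (gam - 1))).
Variables (g : V -> R) (G : R).
Hypothesis (mg : measurable_fun setT g) (g1 : (\int[mu]_x (`|g x|)%:E < +oo)%E)
  (G0 : 0 < G) (gG : \forall x \ae mu, `|g x| <= G).
Local Notation F := (shifted_primitive f a).
Local Notation M := (C + a).
Local Notation I := (energy s f g a).

Let gam2' : 2 < gam. Proof. by case/andP: gam2. Qed.
Let gamq : gam <= q. Proof. by case/andP: gam2 => _ /ltW. Qed.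
Let gam1 : 0 < gam - 1. Proof. by case/andP: gam2 => ? _; lra. Qed.
Let M0 : 0 < M. Proof. by rewrite ltr_wpDr. Qed.
Let mF : measurable_fun setT F.
Proof. exact: (measurable_shifted_primitive cf gam2' C0 a0 fC). Qed.

Lemma integrable_potential v : measurable_fun setT v -> (int_pow q v < +oo)%E ->
  mu.-integrable setT (fun x => (g x * F (v x))%:E).
Proof.
move=> mv vq.
have mvq : measurable_fun setT (fun x => `|v x| `^ q) by exact: measurable_pow_norm.
apply/integrableP; split.
  by apply/measurable_EFinP; apply: measurable_funM => //; exact: measurableT_comp.
pose B : V -> \bar R := fun x => ((2 * M)%:E * ((`|g x|)%:E + G%:E * (`|v x| `^ q)%:E))%E.
have mB1 : measurable_fun setT (fun x => (G%:E * (`|v x| `^ q)%:E)%E).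
  by apply: measurable_funeM; apply/measurable_EFinP.
have mg' : measurable_fun setT (fun x => (`|g x|)%:E : \bar R).
  by apply/measurable_EFinP; exact: measurableT_comp.
have b0 x : (0 <= G%:E * (`|v x| `^ q)%:E)%E by rewrite mule_ge0 ?lee_fin ?powR_ge0// ltW.
apply: (@le_lt_trans _ _ (\int[mu]_x B x)%E).
  apply: ae_ge0_le_integral => //.
  - apply/measurable_EFinP; apply: measurableT_comp => //.
    by apply: measurable_funM => //; exact: measurableT_comp.
  - move=> x _; apply: mule_ge0; last by rewrite adde_ge0.
    by rewrite lee_fin mulr_ge0// ltW.
  - by apply: measurable_funeM; exact: emeasurable_funD.
  - apply: filterS gG => x gx _; rewrite /B.
    suff : `|g x * F (v x)| <= 2 * M * (`|g x| + G * `|v x| `^ q).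
      by rewrite -lee_fin EFinM EFinD (EFinM G).
    rewrite normrM.
    have := shifted_primitive_growth cf gam2' C0 a0 fC (v x) gamq.
    move=> /(ler_wpM2l (normr_ge0 (g x))) /le_trans; apply.
    rewrite mulrCA ler_wpM2l ?mulr_ge0 ?(ltW M0)// mulrDr mulr1 lerD2l.
    by rewrite ler_wpM2r// powR_ge0.
rewrite ge0_integralZl_EFin//; last 3 first.
- by move=> x _; rewrite adde_ge0.
- exact: emeasurable_funD.
- by rewrite mulr_ge0// ltW.
rewrite lte_mul_pinfty ?lee_fin ?mulr_ge0 ?(ltW M0)//.
rewrite ge0_integralD//.
apply: lte_add_pinfty => //.
rewrite ge0_integralZl_EFin ?(ltW G0)//; last by apply/measurable_EFinP.
by rewrite lte_mul_pinfty ?lee_fin ?(ltW G0).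
Qed.

Lemma potential_diff u psi P (t B : R) :
  measurable_fun setT u -> (int_pow q u < +oo)%E ->
  measurable_fun setT psi -> (int_pow q (fun x => u x + t * psi x)%R < +oo)%E ->
  measurable_fun setT P -> (forall x, 0 <= P x) -> (\int[mu]_x (P x)%:E = B%:E)%E ->
  0 < t ->
  (\forall x \ae mu, `|psi x| *
    (1 + `|u x| `^ (gam - 1) + `|u x + t * psi x| `^ (gam - 1)) <= P x) ->
  `|\int[mu]_x (g x * F (u x + t * psi x)) - \int[mu]_x (g x * F (u x))| <=
  t * (M * G * B).
Proof.
move=> mu_ uq mpsi vq mP P0 PB t0 uP.
set v := (fun x => u x + t * psi x) in vq.
have mv : measurable_fun setT v.
  by apply: measurable_funD => //; apply: measurable_funM.
have iu := integrable_potential mu_ uq; have iv := integrable_potential mv vq.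
have iD : mu.-integrable setT (EFin \o (fun x => g x * F (v x) - g x * F (u x))).
  have := integrableB measurableT iv iu; apply: eq_integrable => //.
rewrite -RintegralB// -lee_fin EFin_normr_Rintegral//.
apply: le_trans (le_abse_integral _ _ _) _ => //.
  exact: (measurable_int mu iD).
rewrite [leRHS](_ : _ = \int[mu]_x ((t * (M * G))%:E * (P x)%:E))%E; last first.
  rewrite ge0_integralZl_EFin//.
  - by rewrite PB -EFinM !mulrA.
  - by move=> x _; rewrite lee_fin.
  - exact/measurable_EFinP.
  - by rewrite !mulr_ge0// ltW.
apply: ae_ge0_le_integral => //.
- by apply: measurableT_comp => //; exact: (measurable_int mu iD).
- by move=> x _; rewrite mule_ge0// ?lee_fin// !mulr_ge0// ltW.
- by apply: measurable_funeM; exact/measurable_EFinP.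
apply: filterS2 gG uP => x gx ux _.
rewrite -EFinM /= lee_fin -mulrBr normrM.
apply: (@le_trans _ _ (G * (t * `|psi x| *
   (M * (1 + `|u x| `^ (gam - 1) + `|v x| `^ (gam - 1)))))).
  apply: ler_pM => //.
  have := shifted_primitive_lipschitz cf gam2' C0 a0 fC (u x) (v x).
  by rewrite {1 3}/v addrAC subrr add0r normrM (gtr0_norm t0).
rewrite [leLHS](_ : _ = t * (M * G) * (`|psi x| *
   (1 + `|u x| `^ (gam - 1) + `|v x| `^ (gam - 1)))); last by ring.
by rewrite ler_wpM2l// !mulr_ge0// ltW.
Qed.

Lemma energyE u : (dirichlet s u < +oo)%E ->
  I u = 2^-1 * fine (dirichlet s u) - \int[mu]_x (g x * F (u x)).
Proof.
move=> Du; rewrite /energy gagliardoE; congr (_ * _ - _).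
rewrite fine_poweR -powR_mulrn ?powR_ge0// -powRrM mulVf// powRr1//.
by rewrite fine_ge0// dirichlet_ge0.
Qed.

(** A one-sided difference quotient replaces the weak formulation: the potential
    term is then controlled by a Lipschitz bound along the segment from u to
    u + t psi, with P a majorant of the growth factor uniform in t. *)
Lemma critical_quasiminimal u psi P (B : R) :
  Hdot s u -> critical_point s f g a u -> Hdot s psi ->
  measurable_fun setT P -> (forall x, 0 <= P x) -> (\int[mu]_x (P x)%:E = B%:E)%E ->
  (forall t, 0 < t < 1 -> \forall x \ae mu, `|psi x| *
    (1 + `|u x| `^ (gam - 1) + `|u x + t * psi x| `^ (gam - 1)) <= P x) ->
  forall e, 0 < e -> exists2 t0, 0 < t0 & forall t, 0 < t < t0 -> t < 1 ->
    fine (dirichlet s u) <= fine (dirichlet s (fun x => u x + t * psi x)) +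
      t * (e + 2 * (M * G * B)).
Proof.
move=> Hu crit Hpsi mP P0 PB uP e e0.
have [mu_ Du Lu] := (HdotP hs hN u).1 Hu.
have [mpsi Dpsi Lpsi] := (HdotP hs hN psi).1 Hpsi.
have nfin : Hdot_norm s psi \is a fin_num.
  by rewrite ge0_fin_numE ?Hdot_norm_ge0//; case: Hpsi.
have n0 := Hdot_norm_ge0 s psi.
set h := fine (Hdot_norm s psi).
have h0 : 0 <= h by rewrite fine_ge0.
have hE : Hdot_norm s psi = h%:E by rewrite fineK.
have h1 : 0 < 2 * (h + 1) by rewrite mulr_gt0// ltr_wpDl.
have [d d0 Hd] := crit (e / (2 * (h + 1))) (divr_gt0 e0 h1).
exists (d / (h + 1)) => [|t /andP[t0 td] t1].
  by rewrite divr_gt0// ltr_wpDl.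
have Ht := HdotZ hs hN t Hpsi.
have nt : Hdot_norm s (fun x => t * psi x) = (t * h)%:E.
  by rewrite Hdot_normZ ?(ltW t0)// hE EFinM.
have := Hd _ Ht; rewrite nt !lee_fin => /(_ _) H.
have {}H : `|I (u \+ (fun x => t * psi x)) - I u| <= e / (2 * (h + 1)) * (t * h).
  apply: H; move: td; rewrite ltr_pdivlMr ?ltr_wpDl// => td.
  by apply: le_trans (ltW td); rewrite ler_wpM2l ?(ltW t0)// lerDl.
have [_ Dv Lv] := (HdotP hs hN _).1 (HdotD hs hN Hu Ht).
have := potential_diff mu_ Lu mpsi Lv mP P0 PB t0 (uP t _); rewrite t0 t1 => /(_ isT).
move: H; rewrite !energyE// => H1 H2.
have {}H1 : `|I (u \+ (fun x => t * psi x)) - I u| <= e / 2 * t.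
  rewrite !energyE//; apply: le_trans H1 _.
  rewrite [leLHS](_ : _ = e / 2 * t * (h / (h + 1))); last first.
    by field; rewrite gt_eqF// ltr_wpDl.
  rewrite ler_piMr ?mulr_ge0 ?divr_ge0 ?(ltW e0) ?(ltW t0)//.
  by rewrite ler_pdivrMr ?mul1r ?lerDl// ltr_wpDl.
move: H1 H2; rewrite !energyE// !ler_norml.
set X := fine (dirichlet s u); set Y := fine (dirichlet s _).
set U := \int[mu]_x (g x * F (u x)); set W := \int[mu]_x (g x * F (u x + t * psi x)).
rewrite -/W => /andP[H1 _] /andP[H2 H3].
move: H1 H2 H3; set Z := M * G * B => H1 H2 H3; lra.
Qed.

(** With X, Y the two values of the truncation, the square of
    x - y - t sg (X - Y) expands to (x - y)^2 - 2 t sg (x - y) (X - Y) + t^2 (X - Y)^2,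
    where monotonicity bounds the middle term. The inequality is doubled to fit
    [le_dirichlet_comb]. *)
Lemma diffquot_quasi_excess (sg t k : R) u (z : V * V) : sg ^+ 2 = 1 -> 0 < t ->
  diffquot s (fun x => u x + t * (- sg * excess k (fun x => sg * u x) x)) z +
  diffquot s (fun x => u x + t * (- sg * excess k (fun x => sg * u x) x)) z +
  (2 * (2 * t - t ^+ 2)) * diffquot s (excess k (fun x => sg * u x)) z <=
  diffquot s u z + diffquot s u z.
Proof.
move=> sg1 t0; rewrite /diffquot /excess mulrA -[X in X + _]mulrDl -[leLHS]mulrDl -[leRHS]mulrDl.
rewrite ler_wpM2r ?kernel_ge0//.
have := excess_monotone k (sg * u z.1) (sg * u z.2) => /=.
set X := Num.max _ _; set Y := Num.max _ _; set x := u z.1; set y := u z.2 => h.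
rewrite (_ : x + _ - (y + _) = (x - y) - t * sg * (X - Y)); last by ring.
have -> : (x - y - t * sg * (X - Y)) ^+ 2 = (x - y) ^+ 2 -
    2 * t * ((sg * x - sg * y) * (X - Y)) + t ^+ 2 * (sg ^+ 2) * (X - Y) ^+ 2 by ring.
rewrite sg1.
have := ler_wpM2l (ltW t0) h; nra.
Qed.

(** The sign sg treats u and - u at once. The perturbation - t sg (sg u - k)_+
    decreases |u|, so that the growth of f at u majorizes the growth along the
    whole path. *)
Lemma caccioppoli u (sg k : R) : sg ^+ 2 = 1 -> 0 < k ->
  Hdot s u -> critical_point s f g a u ->
  (dirichlet s (excess k (fun x => sg * u x)%R) <= \int[mu]_x (4 * M * G *
    (excess k (fun x => sg * u x)%R x * (1 + `|sg * u x| `^ (gam - 1))))%:E)%E.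
Proof.
move=> sg1 k0 Hu crit.
have [mu_ Du Lu] := (HdotP hs hN u).1 Hu.
pose w x := sg * u x; rewrite -/w; pose phi := excess k w.
have sgn1 : `|sg| = 1.
  by apply/eqP; rewrite -sqrp_eq1// real_normK ?num_real// sg1.
have wu x : `|w x| = `|u x| by rewrite normrM sgn1 mul1r.
have Hw : Hdot s w by exact: HdotZ.
have [mw Dw Lw] := (HdotP hs hN w).1 Hw.
have Hphi : Hdot s phi by apply: Hdot_excess => //; exact: ltW.
have [mphi Dphi Lphi] := (HdotP hs hN phi).1 Hphi.
pose psi x := - sg * phi x.
have Hpsi : Hdot s psi by exact: HdotZ.
pose P x := 2 * (phi x * (1 + `|w x| `^ (gam - 1))).
have phi0 x : 0 <= phi x by exact: excess_ge0.
have P0 x : 0 <= P x by rewrite mulr_ge0// mulr_ge0 ?phi0// addr_ge0 ?powR_ge0.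
have mP : measurable_fun setT P.
  apply: measurable_funM => //; apply: measurable_funM => //.
  by apply: measurable_funD => //; exact: measurable_pow_norm.
have rhsE : (\int[mu]_x (4 * M * G * (phi x * (1 + `|w x| `^ (gam - 1))))%:E =
    (2 * M * G)%:E * \int[mu]_x (P x)%:E)%E.
  rewrite -ge0_integralZl_EFin//.
  - by apply: eq_integral => x _; rewrite -EFinM /P; congr EFin; ring.
  - by move=> x _; rewrite lee_fin.
  - exact/measurable_EFinP.
  - by rewrite !mulr_ge0// ltW.
rewrite rhsE.
case E : (\int[mu]_x (P x)%:E)%E => [B| |]; last 2 first.
- by rewrite gt0_muley ?leey// lte_fin !mulr_gt0.
- have : (0 <= \int[mu]_x (P x)%:E)%E by apply: integral_ge0 => x _; rewrite lee_fin.
  by rewrite E.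
have bound t : 0 < t < 1 -> \forall x \ae mu, `|psi x| *
    (1 + `|u x| `^ (gam - 1) + `|u x + t * psi x| `^ (gam - 1)) <= P x.
  move=> /andP[t0 t1]; apply: aeW => x.
  rewrite /P /psi normrM normrN sgn1 mul1r (ger0_norm (phi0 x)) [leRHS]mulrCA.
  rewrite ler_wpM2l ?phi0//.
  have le1 : `|u x + t * (- sg * phi x)| <= `|u x|.
    rewrite -[leLHS]mul1r -sgn1 -normrM -wu.
    rewrite (_ : sg * _ = w x - sg ^+ 2 * (t * phi x)); last by rewrite /w; ring.
    rewrite sg1 mul1r /phi /excess.
    have [wk|wk] := leP (w x - k) 0; first by rewrite mulr0 subr0.
    have wx0 : 0 < w x by lra.
    by rewrite !ger0_norm//; nra.
  have := powR_ge0 `|w x| (gam - 1).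
  have : `|u x + t * (- sg * phi x)| `^ (gam - 1) <= `|w x| `^ (gam - 1).
    by rewrite ler_powR2r// wu.
  rewrite wu; lra.
have [mpsi _ _] := (HdotP hs hN psi).1 Hpsi.
have key e : 0 < e -> fine (dirichlet s phi) <= e + 2 * (M * G * B).
  move=> e0.
  have [t0 t00 Ht] := critical_quasiminimal Hu crit Hpsi mP P0 E bound e0.
  pose t := Num.min (t0 / 2) 2^-1.
  have t_gt0 : 0 < t by rewrite lt_min !divr_gt0//=.
  have t_lt : t < t0.
    by apply: (@le_lt_trans _ _ (t0 / 2)); rewrite ?ge_min ?lexx// ltr_pdivrMr//; lra.
  have t_le : t <= 2^-1 by rewrite ge_min lexx orbT.
  have t1 : t < 1 by lra.
  have := Ht t; rewrite t_gt0 t_lt => /(_ isT t1).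
  have Hv : Hdot s (fun x => u x + t * psi x) by apply: HdotD => //; exact: HdotZ.
  have [mv Dv _] := (HdotP hs hN _).1 Hv.
  have c0 : 0 <= 2 * (2 * t - t ^+ 2) by nra.
  have := le_dirichlet_comb c0 mv mv mphi mu_ mu_
    (fun z => diffquot_quasi_excess k u z sg1 t_gt0).
  have [d1 d10 ->] := dirichlet_fin Dv; have [d2 d20 ->] := dirichlet_fin Du.
  have [d3 d30 ->] := dirichlet_fin Dphi.
  rewrite -!EFinM -!EFinD lee_fin /= => h1 h2.
  set Z := e + _ in h2 *.
  have h3 : (2 * t - t ^+ 2) * d3 <= t * Z by lra.
  have h4 : t * ((2 - t) * d3) <= t * Z by lra.
  rewrite ler_pM2l// in h4; nra.
rewrite -EFinM -(@fineK _ (dirichlet s phi)) ?ge0_fin_numE ?dirichlet_ge0// lee_fin.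
apply/ler_addgt0Pr => e e0; have := key e e0; rewrite addrC; lra.
Qed.

(** The cross terms of the two squares add up to
    - 2 t ((v - u)(x) - (v - u)(y)) (X - Y), where X, Y are the two values of the
    truncation of v - u. *)
Lemma diffquot_quasi_shift (t k : R) u v (z : V * V) : 0 < t ->
  diffquot s (u \+ (fun x => t * excess k (v \- u) x)) z +
  diffquot s (v \+ (fun x => - t * excess k (v \- u) x)) z +
  (2 * t - 2 * t ^+ 2) * diffquot s (excess k (v \- u)) z <=
  diffquot s u z + diffquot s v z.
Proof.
move=> t0; rewrite /diffquot /excess mulrA -[X in X + _]mulrDl -[leLHS]mulrDl -[leRHS]mulrDl.
rewrite ler_wpM2r ?kernel_ge0//=.
have := excess_monotone k (v z.1 - u z.1) (v z.2 - u z.2) => /=.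
set X := Num.max _ _; set Y := Num.max _ _.
set x := u z.1; set y := u z.2; set x' := v z.1; set y' := v z.2 => h.
rewrite (_ : x + t * X - (y + _) = (x - y) + t * (X - Y)); last by ring.
rewrite (_ : x' + - t * X - (y' + _) = (x' - y') - t * (X - Y)); last by ring.
rewrite (_ : (x - y + t * (X - Y)) ^+ 2 + _ = (x - y) ^+ 2 + (x' - y') ^+ 2 -
    2 * t * ((x' - x - (y' - y)) * (X - Y)) + 2 * t ^+ 2 * (X - Y) ^+ 2); last by ring.
have := ler_wpM2l (ltW t0) h; nra.
Qed.

(** The growth factor along a path from a value at most K in modulus whose
    displacement is at most 2K. *)
Definition growth_sum (K : R) : R := 1 + K `^ (gam - 1) + (3 * K) `^ (gam - 1).

(** Two perturbations of the same critical point u are used, phi and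
    - phi(. - z) with phi the truncation of u(. + z) - u. By translation
    invariance the second amounts to perturbing u(. + z) by - phi. *)
Lemma caccioppoli_shift u (K k : R) (z : V) : 0 < K -> 0 < k ->
  Hdot s u -> critical_point s f g a u ->
  (\forall x \ae mu, `|u x| <= K) ->
  (dirichlet s (excess k (shift z u \- u)%R) <= \int[mu]_x
    (4 * M * G * growth_sum K * (excess k (shift z u \- u)%R x *
       (1 + `|(shift z u \- u)%R x| `^ (gam - 1))))%:E)%E.
Proof.
move=> K0 k0 Hu crit uK.
have [mu_ Du Lu] := (HdotP hs hN u).1 Hu.
pose w := shift z u \- u; rewrite -/w; pose phi := excess k w.
have Huz := Hdot_shift hs hN z Hu.
have Hw : Hdot s w.
  have -> : w = shift z u \+ (fun x => -1 * u x).
    by apply/funext => x; rewrite /w /= mulN1r.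
  by apply: HdotD => //; exact: HdotZ.
have [mw Dw Lw] := (HdotP hs hN w).1 Hw.
have Hphi : Hdot s phi by apply: Hdot_excess => //; exact: ltW.
have [mphi Dphi Lphi] := (HdotP hs hN phi).1 Hphi.
pose psi := shift (- z) (fun x => -1 * phi x).
have Hpsi : Hdot s psi by apply: Hdot_shift => //; exact: HdotZ.
have L0 : 0 < growth_sum K by rewrite /growth_sum -addrA ltr_wpDr// addr_ge0 ?powR_ge0.
pose P x := growth_sum K * phi x.
pose P' := shift (- z) P.
have phi0 x : 0 <= phi x by exact: excess_ge0.
have P0 x : 0 <= P x by rewrite mulr_ge0// ltW.
have mP : measurable_fun setT P by exact: measurable_funM.
have mP' : measurable_fun setT P' by exact: measurable_shift.
apply: (@le_trans _ _ ((4 * M * G)%:E * \int[mu]_x (P x)%:E)%E); last first.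
  rewrite -ge0_integralZl_EFin//; last 3 first.
  - by move=> x _; rewrite lee_fin.
  - exact/measurable_EFinP.
  - by rewrite !mulr_ge0// ltW.
  apply: ge0_le_integral => //.
  - by move=> x _; rewrite lee_fin !mulr_ge0// ltW.
  - by apply: measurable_funeM; exact/measurable_EFinP.
  - apply/measurable_EFinP; apply: measurable_funM => //; apply: measurable_funM => //.
    by apply: measurable_funD => //; exact: measurable_pow_norm.
  - move=> x _; rewrite -EFinM lee_fin /P [leLHS]mulrA.
    by rewrite ler_wpM2l ?mulr_ge0 ?(ltW M0) ?(ltW G0) ?(ltW L0)// ler_peMr// lerDl powR_ge0.
case E : (\int[mu]_x (P x)%:E)%E => [B| |]; last 2 first.
- by rewrite gt0_muley ?leey// lte_fin !mulr_gt0.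
- have : (0 <= \int[mu]_x (P x)%:E)%E by apply: integral_ge0 => x _; rewrite lee_fin.
  by rewrite E.
have E' : (\int[mu]_x (P' x)%:E)%E = B%:E.
  rewrite -E; apply: (ge0_integral_shift (- z) (f := fun x => (P x)%:E)).
    exact/measurable_EFinP.
  by move=> x; rewrite lee_fin.
have phiK : \forall x \ae mu, phi x <= 2 * K.
  apply: filterS2 uK (ae_shift z uK) => x u1 u2.
  have : phi x <= `|w x| by apply: excess_le; exact: ltW.
  move=> /le_trans; apply; rewrite /w /= /shift.
  by apply: (le_trans (ler_normB _ _)); lra.
have bound (t : R) (x y p : R) : 0 < t < 1 -> 0 <= p <= 2 * K -> `|x| <= K ->
    `|y| <= t * p -> 1 + `|x| `^ (gam - 1) + `|x + y| `^ (gam - 1) <= growth_sum K.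
  move=> /andP[t0 t1] /andP[p0 pK] xK yp; rewrite /growth_sum -!addrA lerD2l lerD//.
    by rewrite ler_powR2r// ltW.
  rewrite ler_powR2r ?mulr_ge0 ?(ltW K0)//.
  apply: (le_trans (ler_normD _ _)).
  have : t * p <= p by rewrite ler_piMl// ltW.
  lra.
have bound1 t : 0 < t < 1 -> \forall x \ae mu, `|phi x| *
    (1 + `|u x| `^ (gam - 1) + `|u x + t * phi x| `^ (gam - 1)) <= P x.
  move=> t01; apply: filterS2 uK phiK => x ux px.
  rewrite (ger0_norm (phi0 x)) /P mulrC ler_wpM2r//.
  apply: (bound t _ _ (phi x)) => //; first by rewrite phi0.
  by rewrite normrM (ger0_norm (phi0 x)) gtr0_norm//; case/andP: t01.
have bound2 t : 0 < t < 1 -> \forall x \ae mu, `|psi x| *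
    (1 + `|u x| `^ (gam - 1) + `|u x + t * psi x| `^ (gam - 1)) <= P' x.
  move=> t01; apply: filterS2 uK (ae_shift (- z) phiK) => x ux px.
  have psiE : `|psi x| = phi (x - z).
    by rewrite /psi /shift mulN1r normrN ger0_norm.
  rewrite psiE /P' /shift /P mulrC ler_wpM2r//.
  apply: (bound t _ _ (phi (x - z))) => //; first by rewrite phi0.
  by rewrite normrM psiE gtr0_norm//; case/andP: t01.
have key e : 0 < e -> fine (dirichlet s phi) <= 2 * e + 4 * (M * G * B).
  move=> e0.
  have [t1 t10 Ht1] := critical_quasiminimal Hu crit Hphi mP P0 E bound1 e0.
  have [t2 t20 Ht2] := critical_quasiminimal Hu crit Hpsi mP' (fun x => P0 (x - z)) E' bound2 e0.
  pose t := Num.min (Num.min (t1 / 2) (t2 / 2)) 2^-1.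
  have t_gt0 : 0 < t by rewrite !lt_min !divr_gt0//=.
  have t_lt1 : t < t1.
    by apply: (@le_lt_trans _ _ (t1 / 2)); rewrite ?ge_min ?lexx// ltr_pdivrMr//; lra.
  have t_lt2 : t < t2.
    by apply: (@le_lt_trans _ _ (t2 / 2)); rewrite ?ge_min ?lexx ?orbT// ltr_pdivrMr//; lra.
  have t_le : t <= 2^-1 by rewrite ge_min lexx orbT.
  have tlt1 : t < 1 by lra.
  have := Ht1 t; rewrite t_gt0 t_lt1 => /(_ isT tlt1).
  have := Ht2 t; rewrite t_gt0 t_lt2 => /(_ isT tlt1).
  have Htphi := HdotZ hs hN t Hphi.
  have HNtphi := HdotZ hs hN (- t) Hphi.
  have Hv1 := HdotD hs hN Hu Htphi.
  have Hv2 := HdotD hs hN Huz HNtphi.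
  have [mv1 Dv1 _] := (HdotP hs hN _).1 Hv1.
  have [mv2 Dv2 _] := (HdotP hs hN _).1 Hv2.
  have [muz _ _] := (HdotP hs hN _).1 Huz.
  have c0 : 0 <= 2 * t - 2 * t ^+ 2 by nra.
  have := le_dirichlet_comb c0 mv1 mv2 mphi mu_ muz
    (fun y => diffquot_quasi_shift k u (shift z u) y t_gt0).
  have -> : dirichlet s (fun x => u x + t * psi x) =
      dirichlet s (shift z u \+ (fun x => - t * phi x)).
    rewrite -(dirichlet_shift s z); last first.
      have [mpsi _ _] := (HdotP hs hN _).1 Hpsi.
      by apply: measurable_funD => //; exact: measurable_funM.
    congr dirichlet; apply/funext => x; rewrite /shift /psi /=.
    by rewrite /shift addrK mulN1r mulrN mulNr.
  rewrite dirichlet_shift//.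
  have [d1 d10 ->] := dirichlet_fin Dv1; have [d4 d40 ->] := dirichlet_fin Dv2.
  have [d2 d20 ->] := dirichlet_fin Du; have [d3 d30 ->] := dirichlet_fin Dphi.
  rewrite -!EFinM -!EFinD lee_fin /= => h1 h2 h2'.
  set Z := e + _ in h2 h2'.
  have h3 : (2 * t - 2 * t ^+ 2) * d3 <= 2 * (t * Z) by lra.
  have h4 : t * ((2 - 2 * t) * d3) <= t * (2 * Z) by lra.
  rewrite ler_pM2l// in h4.
  have h5 : d3 <= 2 * Z by nra.
  by move: h5; rewrite /Z; lra.
rewrite -EFinM -(@fineK _ (dirichlet s phi)) ?ge0_fin_numE ?dirichlet_ge0// lee_fin.
apply/ler_addgt0Pr => e e0; have e2 : 0 < e / 2 by rewrite divr_gt0.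
by have := key _ e2; lra.
Qed.

End energy_estimates.

(** * Boundedness, equicontinuity, and the theorem *)

Section regularity.
Context (R : realType) (N : nat).
Variable s : R.
Hypothesis (hs : 0 < s < 1) (hN : 2 * s < N%:R).
Local Notation V := 'rV[R]_N.
Local Notation mu := (lebesgue_rV R N).
Local Notation q := (critical_exponent N s).
Implicit Types (u v w phi psi P : V -> R).
Variable f : R -> R.
Hypothesis (cf : {within `[0, +oo[, continuous f}).
Variables (gam C : R).
Hypothesis (gam2 : 2 < gam < q) (C0 : 0 < C).
Hypothesis (fC : forall t, 0 <= t -> `|f t| <= C * (1 + t `^ (gam - 1))).
Variables (g : V -> R) (G : R).
Hypothesis (mg : measurable_fun setT g) (g1 : (\int[mu]_x (`|g x|)%:E < +oo)%E)
  (G0 : 0 < G) (gG : \forall x \ae mu, `|g x| <= G).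

Let gam1q : 1 < gam <= q. Proof. by case/andP: gam2 => ? ?; apply/andP; split; lra. Qed.

(** The constant 4 (C + a) G of the Caccioppoli inequality is at most
    4 (C + amax) G, which makes K independent of a. *)
Lemma uniform_bound (amax D : R) : 0 < amax -> 0 < D ->
  exists2 K : R, 0 < K & forall a u, 0 < a < amax ->
    Hdot s u -> critical_point s f g a u -> (Hdot_norm s u <= D%:E)%E ->
    \forall x \ae mu, `|u x| <= K.
Proof.
move=> amax0 D0; have q2 := critical_exponent_gt2 hs hN.
have q0 := critical_exponent_gt0 hs hN.
have [c c0 DG] := degiorgi hs hN.
have [gam_gt2 gam_ltq] := andP gam2.
have th0 : 0 <= 1 - 2 / q by rewrite subr_ge0 ler_pdivrMr// mul1r ltW.
set E := (D `^ q) `^ (1 - 2 / q); have E0 : 0 <= E by exact: powR_ge0.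
have [M1 M10 M1E] : exists2 M1 : R, 0 < M1 & M1 = 4 * (C + amax) * G.
  by exists (4 * (C + amax) * G); rewrite ?mulr_gt0// addr_gt0.
(* X measures how large K^(q - gam) has to be for the smallness condition. *)
have [X X1 XE] : exists2 X : R, 1 <= X & M1 * 2 * E = c * (X - 1).
  exists (M1 * 2 * E / c + 1); last by rewrite addrK mulrCA divff ?mulr1// gt_eqF.
  rewrite lerDr; apply: divr_ge0; last exact: ltW.
  by apply: mulr_ge0 => //; rewrite mulr_ge0// ltW.
have X0 : 0 < X by apply: lt_le_trans X1.
have [K K1 KX] : exists2 K : R, 1 <= K & K `^ gam * K `^ (- q) = X^-1.
  exists (X `^ (q - gam)^-1).
    have <- : 1 `^ (q - gam)^-1 = 1 :> R by rewrite powR1.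
    by rewrite ler_powR2r ?invr_gt0 ?subr_gt0 ?(ltW X0).
  rewrite -powRD; last by rewrite (gt_eqF (powR_gt0 _ X0)) implybT.
  rewrite -powRrM (_ : _ * _ = - 1); first by rewrite powR_inv1 ?(ltW X0).
  by field; rewrite subr_eq0 gt_eqF.
have K0 : 0 < K by apply: lt_le_trans K1.
exists K => // a u /andP[a0 aa] Hu crit uD.
have [mu_ Du Lu] := (HdotP hs hN u).1 Hu.
have LuD := int_pow_le_Hdot_norm hs hN (ltW D0) uD.
have one_sided sg : sg ^+ 2 = 1 -> \forall x \ae mu, sg * u x <= K.
  move=> sg1; pose w x := sg * u x.
  have sgn1 : `|sg| = 1.
    by apply/eqP; rewrite -sqrp_eq1// real_normK ?num_real// sg1.
  have Lw : int_pow q w = int_pow q u.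
    by apply: eq_integral => x _; rewrite /w normrM sgn1 mul1r.
  have mw : measurable_fun setT w by exact: measurable_funM.
  have Ma0 : 0 <= 4 * (C + a) * G := mulr_ge0
    (mulr_ge0 (ler0n _ 4) (addr_ge0 (ltW C0) (ltW a0))) (ltW G0).
  have MaM1 : 4 * (C + a) * G <= M1.
    by rewrite M1E ler_wpM2r ?(ltW G0)// ler_wpM2l// lerD2l ltW.
  apply: (DG w gam _ K (D `^ q) mw gam1q Ma0 K0).
  - by rewrite Lw.
  - move=> k k0; exact: (caccioppoli hs hN cf gam2 C0 (ltW a0) fC mg g1 G0 gG sg1 k0 Hu crit).
  have KK : (K + K `^ gam) * K `^ (- q) <= 2 * X^-1.
    rewrite -KX mulrA ler_wpM2r ?powR_ge0// mulr_natl mulr2n lerD2r.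
    by rewrite le1r_powR//; lra.
  have KK0 : 0 <= (K + K `^ gam) * K `^ (- q).
    exact: mulr_ge0 (addr_ge0 (ltW K0) (powR_ge0 _ _)) (powR_ge0 _ _).
  apply: (@le_trans _ _ (M1 * (2 * X^-1) * E)).
    exact: ler_wpM2r E0 _ _ (ler_pM Ma0 KK0 MaM1 KK).
  rewrite [leLHS](_ : _ = c * ((X - 1) / X)); last by rewrite mulrA -XE; ring.
  rewrite ler_piMr ?(ltW c0)// ler_pdivrMr// mul1r gerBl; exact: ler01.
have h1 := one_sided 1 (expr1n _ _).
have h2 : \forall x \ae mu, -1 * u x <= K by apply: one_sided; rewrite sqrrN expr1n.
apply: filterS2 h1 h2 => x; rewrite mul1r mulN1r => ? ?.
by rewrite ler_norml lerNl; apply/andP.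
Qed.

Lemma int_pow_interpolation p0 p w (b : R) : 0 < p0 <= p ->
  measurable_fun setT w -> 0 < b -> (\forall x \ae mu, `|w x| <= b) ->
  (int_pow p w <= (b `^ (p - p0))%:E * int_pow p0 w)%E.
Proof.
move=> /andP[p00 pp0] mw b0 wb.
have mwp p' : measurable_fun setT (fun x : V => (`|w x| `^ p')%:E).
  by apply/measurable_EFinP; exact: measurable_pow_norm.
rewrite -ge0_integralZl_EFin ?powR_ge0//.
apply: ae_ge0_le_integral => //.
- by move=> x _; rewrite -EFinM lee_fin mulr_ge0 ?powR_ge0.
- exact: measurable_funeM.
apply: filterS wb => x wx _; rewrite -EFinM lee_fin.
have [->|w0] := eqVneq (w x) 0.
  by rewrite normr0 !powR0 ?mulr0//; apply/eqP; lra.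
rewrite -[in leLHS](subrK p0 p) powRD; last by rewrite normr_eq0 w0 implybT.
by rewrite ler_wpM2r ?powR_ge0// ge0_ler_powR ?nnegrE ?subr_ge0// ltW.
Qed.

(** Here the height e is prescribed, and the smallness condition is met through
    the norm of the difference, which interpolates between the small L^2 norm
    and the bound 2K. *)
Lemma uniform_shift a u (K : R) : 0 <= a -> 0 < K ->
  Hdot s u -> critical_point s f g a u -> (\forall x \ae mu, `|u x| <= K) ->
  forall e, 0 < e -> exists2 r, 0 < r &
    forall z, cube 0 r z -> \forall x \ae mu, u (x + z) - u x <= e.
Proof.
move=> a0 K0 Hu crit uK e e0.
have q2 := critical_exponent_gt2 hs hN; have q0 := critical_exponent_gt0 hs hN.
have [c c0 DG] := degiorgi hs hN.
have th0 : 0 < 1 - 2 / q by rewrite subr_gt0 ltr_pdivrMr// mul1r.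
have [mu_ Du Lu] := (HdotP hs hN u).1 Hu.
have L0 : 0 < growth_sum gam K.
  by rewrite /growth_sum -addrA ltr_wpDr// addr_ge0 ?powR_ge0.
pose M1 := 4 * (C + a) * G * growth_sum gam K.
have M10 : 0 < M1 by rewrite !mulr_gt0// ltr_wpDr.
pose B := M1 * ((e + e `^ gam) * e `^ (- q)).
have B0 : 0 <= B.
  by rewrite mulr_ge0 ?(ltW M10)// mulr_ge0 ?powR_ge0// addr_ge0 ?powR_ge0// ltW.
pose A0 := (c / (B + 1)) `^ (1 - 2 / q)^-1.
have B1 : 0 < B + 1 by rewrite ltr_wpDl.
have A00 : 0 < A0 by rewrite powR_gt0// divr_gt0.
have K20 : 0 < 2 * K by rewrite mulr_gt0.
have Kq0 : 0 < (2 * K) `^ (q - 2) by rewrite powR_gt0.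
have [r r0 small] := shift_L2_continuous hs hN mu_ Du (divr_gt0 A00 Kq0).
exists r => // z rz; pose w := shift z u \- u.
have muz := measurable_shift z mu_.
have mw : measurable_fun setT w by exact: measurable_funB.
have wK : \forall x \ae mu, `|w x| <= 2 * K.
  apply: filterS2 uK (ae_shift z uK) => x u1 u2.
  by apply: (le_trans (ler_normB _ _)); rewrite /shift; lra.
have Lw : (int_pow q w <= A0%:E)%E.
  have q2' : 0 < (2 : R) <= q by rewrite ltr0n ltW.
  apply: (le_trans (int_pow_interpolation q2' mw K20 wK)).
  have h : (int_pow 2 w <= (A0 / (2 * K) `^ (q - 2))%:E)%E.
    rewrite (_ : int_pow 2 w = shift_sq u z); first exact: small.
    apply: eq_integral => x _; congr EFin.
    by rewrite powR_mulrn// real_normK ?num_real.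
  apply: (@le_trans _ _ (((2 * K) `^ (q - 2))%:E * (A0 / (2 * K) `^ (q - 2))%:E)%E).
    by rewrite lee_pmul2l.
  by rewrite -EFinM lee_fin mulrCA divff ?mulr1// gt_eqF.
apply: (DG w gam M1 e A0 mw gam1q (ltW M10) e0 Lw).
  move=> k k0.
  exact: (caccioppoli_shift hs hN cf gam2 C0 a0 fC mg g1 G0 gG z K0 k0 Hu crit uK).
rewrite -/B (_ : A0 `^ (1 - 2 / q) = c / (B + 1)); last first.
  by rewrite /A0 -powRrM mulVf ?gt_eqF// powRr1// divr_ge0// ltW.
by rewrite mulrCA ler_piMr ?(ltW c0)// ler_pdivrMr// mul1r lerDl//.
Qed.

End regularity.

Theorem theorem1p2 (R : realType) (N : nat) (s : R) (f : R -> R)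
    (g : 'rV[R]_N -> R) (rho beta a1 a2 C0 : R) (u : R -> 'rV[R]_N -> R)
    (hs : 0 < s < 1) (hN : 2 * s < N%:R)
    (cf : {within `[0, +oo[, continuous f}) (f0 : f 0 = 0)
    (f1 : condition_f1 f (critical_exponent N s))
    (f2 : condition_f2 f)
    (f1t : condition_f1_tilde f (critical_exponent N s))
    (gL1 : g \in Lfun (lebesgue_rV R N) 1)
    (gLoo : g \in Lfun (lebesgue_rV R N) +oo)
    (g_gt0 : \forall x \ae lebesgue_rV R N, 0 < g x)
    (rho_gt0 : 0 < rho) (beta_gt0 : 0 < beta) (a1_gt0 : 0 < a1)
    (barrier : forall a, 0 < a < a1 -> forall v, Hdot s v ->
      gagliardo s v = rho%:E -> beta <= energy s f g a v)
    (mp : forall a, 0 < a < a1 ->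
      mountain_pass_solution s f g a rho beta (u a))
    (ha2 : 0 < a2 < a1) (C0_gt0 : 0 < C0)
    (uC0 : forall a, 0 < a < a2 -> (Hdot_norm s (u a) <= C0%:E)%E) :
  forall r : \bar R, ((critical_exponent N s)%:E <= r)%E ->
    (forall a, 0 < a < a2 ->
      u a \in Lfun (lebesgue_rV R N) r /\
      has_continuous_representative (u a)) /\
    exists2 C : R, 0 < C &
      forall a, 0 < a < a2 ->
        ('N[lebesgue_rV R N]_r[EFin \o u a] <= C%:E)%E.
Proof.
have a20 : 0 < a2 by case/andP: ha2.
have q0 := critical_exponent_gt0 hs hN.
have [gam [Cf [gam2 Cf0 fC]]] := subcritical_growth cf f1.
have [mg g1] := Lfun1_integrable gL1.
have [G G0 gG] := Lfun_oo_bounded gLoo.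
have sol a : 0 < a < a2 -> Hdot s (u a) /\ critical_point s f g a (u a).
  move=> /andP[a0 aa2]; have a_lt_a1 : 0 < a < a1.
    by rewrite a0/=; apply: lt_trans aa2 _; case/andP: ha2.
  by have [Hu crit _] := mp a a_lt_a1.
have [K K0 uK] := uniform_bound hs hN cf gam2 Cf0 fC mg g1 G0 gG a20 C0_gt0.
have bounded a : 0 < a < a2 -> \forall x \ae lebesgue_rV R N, `|u a x| <= K.
  by move=> ha; have [Hu crit] := sol a ha; exact: (uK a (u a) ha Hu crit (uC0 a ha)).
move=> r qr.
have [C C0' uC] : exists2 C : R, 0 < C & forall a, 0 < a < a2 ->
    ('N[lebesgue_rV R N]_r[EFin \o u a] <= C%:E)%E.
  case: r qr => [r| |//]; rewrite ?lee_fin => qr.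
    exists ((K `^ (r - critical_exponent N s) *
      C0 `^ critical_exponent N s) `^ r^-1); first by rewrite powR_gt0// mulr_gt0 ?powR_gt0.
    move=> a ha; have [Hu _] := sol a ha; have [mu_ _ _] := (HdotP hs hN _).1 Hu.
    have r0 : 0 < r by exact: lt_le_trans qr.
    rewrite LnormE -poweR_EFin; apply: gt0_ler_poweR.
    - by rewrite invr_ge0 ltW.
    - by rewrite in_itv/= int_pow_ge0 leey.
    - by rewrite in_itv/= lee_fin mulr_ge0 ?powR_ge0//= leey.
    have qr' : 0 < critical_exponent N s <= r by rewrite q0.
    apply: (le_trans (int_pow_interpolation qr' mu_ K0 (bounded a ha))).
    rewrite EFinM lee_wpmul2l ?lee_fin ?powR_ge0//.
    by apply: int_pow_le_Hdot_norm => //; [exact: ltW|exact: uC0].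
  exists K => // a ha; rewrite unlock /= lebesgue_rV_gt0.
  by apply/ess_supP; apply: filterS (bounded a ha) => x /=; rewrite lee_fin.
split; last by exists C.
move=> a ha; have [Hu crit] := sol a ha; have [mu_ _ _] := (HdotP hs hN _).1 Hu.
split.
  rewrite inE; apply/andP; split; rewrite inE//=.
  by rewrite /finite_norm; apply: le_lt_trans (uC a ha) _; rewrite ltry.
apply: continuous_representative => //.
have a0 : 0 <= a by case/andP: ha => /ltW.
exact: (uniform_shift hs hN cf gam2 Cf0 fC mg g1 G0 gG a0 K0 Hu crit (bounded a ha)).
Qed.
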